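(* Let $0\neq \nu\in \mathrm{Dom}(L)$ and let $\lambda=\nu+\nu^*$. Let $v_\nu\in V_\nu$ and $v_{\nu^*}\in V_{\nu}^*$ be nonzero highest weight vectors, and let $f\in U(\mathfrak g)^*$ be the linear functional defined by $$f(u)=v_{\nu^*}\big(\pi_\nu(u)v_\nu\big)\qquad (u\in U(\mathfrak g)).$$ Let $k$ be the codegree of $f$. Then $k\geq 1$ and $$f_{(k)}\in S(\mathfrak n)^{\mathfrak n}(\lambda).$$
   Context: Let $G$ be a simply-connected complex semisimple Lie group with Lie algebra $\mathfrak g$, and let $\mathfrak g=\mathfrak n_-+\mathfrak h+\mathfrak n$ be a triangular decomposition: $\mathfrak h$ is a Cartan subalgebra, $\mathfrak b=\mathfrak h+\mathfrak n$ is a Borel subalgebra with nilradical $\mathfrak n$, $\mathfrak n_-$ is the nilradical of the opposite Borel subalgebra, and the positive roots are the roots of $\mathfrak h$ in $\mathfrak n$. $L$ is the lattice of integral linear forms on $\mathfrak h$ and $\mathrm{Dom}(L)$ is the set of dominant elements of $L$. For $\nu\in\mathrm{Dom}(L)$, $\pi_\nu$ on $V_\nu$ denotes the irreducible finite-dimensional representation of $G$ (and of $\mathfrak g$, $U(\mathfrak g)$) with highest weight $\nu$, and $\nu^*\in\mathrm{Dom}(L)$ is the highest weight of the dual module $V_\nu^*$. Elements of $V_\nu^*$ are regarded as linear functionals on $V_\nu$. For a locally finite $G$-module or $\mathfrak h$-stable subspace $M$ and $\mu\in L$, $M(\mu)$ is the $\mu$-weight space for $\mathfrak h$. $S(\mathfrak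 g)$ (resp. $S(\mathfrak n)$) is the graded symmetric algebra, with the action extending the adjoint action by derivations. $S(\mathfrak n)^{\mathfrak n}$ is the space of invariants of $\mathfrak n$ acting on $S(\mathfrak n)$, and $S(\mathfrak n)^{\mathfrak n}(\lambda)$ is its $\lambda$-weight space. The Killing form $(x,y)$ on $\mathfrak g$ is extended to the nonsingular symmetric bilinear form on $S(\mathfrak g)$ for which $S^m(\mathfrak g)$ and $S^n(\mathfrak g)$ are orthogonal when $m\ne n$ and $(x^n,y^n)=n!\,(x,y)^n$ for $x,y\in\mathfrak g$. Let $\tau:S(\mathfrak g)\to U(\mathfrak g)$ be the symmetrization map, i.e. the linear isomorphism sending $x^k\in S^k(\mathfrak g)$ to the $k$-th power of $x$ in $U(\mathfrak g)$, for all $x\in\mathfrak g$, $k\geq 0$. Let $U_n(\mathfrak g)$, $n\in\mathbb N$, be the standard filtration of $U(\mathfrak g)$, with $U_{-1}(\mathfrak g)=0$. A nonzero linear functional $f$ on $U(\mathfrak g)$ has codegree $k\in\mathbb N$ if $k$ is maximal such that $f$ vanishes on $U_{k-1}(\mathfrak g)$. If $f$ has codegree $k\ge1$, then $f_{(k)}\in S^k(\mathfrak g)$ denotes the element representing, with respect to the bilinear form $(\cdot,\cdot)$ on $S(\mathfrak g)$ extending the Killing form, the linear functional $f\circ\tau|_{S^k(\mathfrak g)}$; that is, $(f_{(k)},w)=f(\tau(w))$ for all $w\in S^k(\mathfrak g)$. *)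

(* Defs.v *)
From HB Require Import structures.
From mathcomp Require Import all_boot all_algebra.
From mathcomp Require Export reals complex.

Set Implicit Arguments.
Unset Strict Implicit.
Unset Printing Implicit Defensive.

Import GRing.Theory.
Local Open Scope ring_scope.

HB.mixin Record Vector_isLie (K : fieldType) (g : Type) of Vector K g := {
  lie : g -> g -> g;
  lie_linearl : forall y : g, linear (lie^~ y);
  lie_linearr : forall x : g, linear (lie x);
  lie_xx : forall x : g, lie x x = 0;
  lie_jacobi : forall x y z : g,
    lie x (lie y z) + lie y (lie z x) + lie z (lie x y) = 0
}.

#[short(type="lieAlgType")]
HB.structure Definition LieAlgebra (K : fieldType) :=
  { g of Vector_isLie K g & Vector K g }.

Section Lie.
Variables (K : fieldType) (g : lieAlgType K).
Implicit Types (x y : g) (A I h n : {vspace g}).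

Definition ad x : 'End(g) := linfun (lie x).

Definition lfun_trace (V : vectType K) (f : 'End(V)) : K :=
  \sum_(i < \dim {:V}) coord (vbasis {:V}) i (f (vbasis {:V})`_i).

Definition killing x y : K := lfun_trace (ad x \o ad y)%VF.

Definition liev (A B : {vspace g}) : {vspace g} :=
  <<[seq lie x y | x <- vbasis A, y <- vbasis B]>>%VS.

Definition subalgebra A : Prop :=
  forall x y, x \in A -> y \in A -> lie x y \in A.

Definition ideal_of A I : Prop :=
  (I <= A)%VS /\ forall x y, x \in A -> y \in I -> lie x y \in I.

Definition abelian_alg A : Prop :=
  forall x y, x \in A -> y \in A -> lie x y = 0.

Definition solvable_alg A : Prop :=
  exists m, iter m (fun D => liev D D) A = 0%VS.

Definition nilpotent_alg A : Prop :=
  exists m, iter m (liev A) A = 0%VS.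

Definition semisimple_alg : Prop :=
  forall I, ideal_of fullv I -> solvable_alg I -> I = 0%VS.

Definition diagonalizable_end (V : vectType K) (f : 'End(V)) : Prop :=
  exists2 e : seq V, basis_of fullv e
    & forall v, v \in e -> exists a : K, f v = a *: v.

(* The usual definition inside a complex semisimple Lie algebra: a maximal
   abelian subalgebra all of whose elements are ad-semisimple. *)
Definition cartan_subalgebra h : Prop :=
  [/\ abelian_alg h,
      forall A, abelian_alg A -> (h <= A)%VS -> A = h
    & forall x, x \in h -> diagonalizable_end (ad x)].

Definition borel_subalgebra (b : {vspace g}) : Prop :=
  [/\ subalgebra b, solvable_alg b
    & forall A, subalgebra A -> solvable_alg A -> (b <= A)%VS -> A = b].

Definition nilradical_of (b n : {vspace g}) : Prop :=
  [/\ ideal_of b n, nilpotent_alg n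
    & forall I, ideal_of b I -> nilpotent_alg I -> (I <= n)%VS].

Definition triangular_decomposition (nm h n : {vspace g}) : Prop :=
  [/\ cartan_subalgebra h,
      borel_subalgebra (h + n)%VS /\ nilradical_of (h + n)%VS n,
      borel_subalgebra (h + nm)%VS /\ nilradical_of (h + nm)%VS nm,
      directv (nm + h + n)
    & (nm + h + n)%VS = fullv].

(* Linear forms on h; the carrier of h is the vector space subvs_of h. *)
Definition hform h := 'Hom(subvs_of h, K^o).

Definition weight_vec h (al : hform h) x : Prop :=
  forall t : subvs_of h, lie (vsval t) x = (al t : K) *: x.

Definition is_root h (al : hform h) : Prop :=
  al != 0 /\ exists2 x : g, x != 0 & weight_vec al x.

Definition is_pos_root h n (al : hform h) : Prop :=
  al != 0 /\ exists x : g, [/\ x \in n, x != 0 & weight_vec al x].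

(* The coroot of al is the only element of [g_al, g_(-al)] where al takes the
   value 2; since g_al and g_(-al) are lines, [g_al, g_(-al)] consists of
   single brackets. *)
Definition is_coroot h (al : hform h) (t : subvs_of h) : Prop :=
  al t = 2%:R /\ exists x y : g,
    [/\ weight_vec al x, weight_vec (- al) y & lie x y = vsval t].

Definition integral_form h (nu : hform h) : Prop :=
  forall al t, is_root al -> is_coroot al t -> exists m : int, nu t = m%:~R.

Definition dominant_integral h n (nu : hform h) : Prop :=
  integral_form nu /\
  forall al t, is_pos_root n al -> is_coroot al t ->
    exists m : nat, nu t = m%:R.

Section Representations.
Variable V : vectType K.
Implicit Types (pi : g -> 'End(V)).

Definition lie_rep pi : Prop :=
  linear pi /\
  forall x y, pi (lie x y) = (pi x \o pi y)%VF - (pi y \o pi x)%VF.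

Definition irreducible_rep pi : Prop :=
  fullv <> 0%VS :> {vspace V} /\
  forall W : {vspace V}, (forall x, (pi x @: W <= W)%VS) ->
    W = 0%VS \/ W = fullv.

Definition highest_weight_vec h n pi (nu : hform h) (v : V) : Prop :=
  [/\ v != 0, forall x, x \in n -> pi x v = 0
    & forall t : subvs_of h, pi (vsval t) v = (nu t : K) *: v].

End Representations.

Definition dual_space (V : vectType K) := 'Hom(V, K^o).

Definition dual_rep (V : vectType K) (pi : g -> 'End(V)) (x : g) :
    'End(dual_space V) :=
  linfun (fun phi : dual_space V => - (phi \o pi x)%VF).

Definition lspan (M : lmodType K) (P : M -> Prop) (w : M) : Prop :=
  exists m (c : 'I_m -> K) (p : 'I_m -> M),
    (forall i, P (p i)) /\ w = \sum_(i < m) c i *: p i.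

Definition is_enveloping_algebra (U : algType K) (iota : {linear g -> U}) :
    Prop :=
  (forall x y, iota (lie x y) = iota x * iota y - iota y * iota x) /\
  forall (A : algType K) (phi : {linear g -> A}),
    (forall x y, phi (lie x y) = phi x * phi y - phi y * phi x) ->
    exists psi : {lrmorphism U -> A},
      (forall x, psi (iota x) = phi x) /\
      forall psi' : {lrmorphism U -> A},
        (forall x, psi' (iota x) = phi x) -> psi' =1 psi.

Definition is_symmetric_algebra (S : comAlgType K) (sigma : {linear g -> S}) :
    Prop :=
  forall (A : comAlgType K) (phi : {linear g -> A}),
    exists psi : {lrmorphism S -> A},
      (forall x, psi (sigma x) = phi x) /\
      forall psi' : {lrmorphism S -> A},
        (forall x, psi' (sigma x) = phi x) -> psi' =1 psi.

Section Enveloping.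
Variables (U : algType K) (iota : {linear g -> U}).

(* U_(k-1), with strict inequality so that k = 0 gives U_(-1) = 0. *)
Definition Ufilt_lt (k : nat) : U -> Prop :=
  lspan (fun u => exists2 s : seq g, (size s < k)%N
                                   & u = \prod_(x <- s) iota x).

Definition is_codegree (f : U -> K) (k : nat) : Prop :=
  [/\ exists u, f u != 0,
      forall u, Ufilt_lt k u -> f u = 0
    & forall k', (forall u, Ufilt_lt k' u -> f u = 0) -> (k' <= k)%N].

Definition extends_rep (V : vectType K) (pi : g -> 'End(V))
    (piU : U -> 'End(V)) : Prop :=
  [/\ linear piU, piU 1 = \1%VF,
      forall a b, piU (a * b) = (piU a \o piU b)%VF
    & forall x, piU (iota x) = pi x].

End Enveloping.

Section Symmetric.
Variables (S : comAlgType K) (sigma : {linear g -> S}).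

Definition Sgr (k : nat) : S -> Prop :=
  lspan (fun w => exists2 s : seq g, size s = k
                                   & w = \prod_(x <- s) sigma x).

(* S(A), as the subalgebra of S(g) generated by A. *)
Definition Ssub A : S -> Prop :=
  lspan (fun w => exists2 s : seq g, {subset s <= A}
                                   & w = \prod_(x <- s) sigma x).

Definition is_adjoint_action (adS : g -> S -> S) : Prop :=
  forall x, [/\ linear (adS x),
      forall a b, adS x (a * b) = adS x a * b + a * adS x b
    & forall y, adS x (sigma y) = sigma (lie x y)].

Definition is_killing_extension (B : S -> S -> K) : Prop :=
  [/\ forall a, linear (B a : S -> K^o),
      forall a b, B a b = B b a,
      forall m m' a b, m <> m' -> Sgr m a -> Sgr m' b -> B a b = 0
    & forall m x y, B (sigma x ^+ m) (sigma y ^+ m)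
                    = (m`!)%:R * killing x y ^+ m].

(* S(n)^n (la) *)
Definition Sn_inv_weight h n (adS : g -> S -> S) (la : hform h) (w : S) :
    Prop :=
  [/\ Ssub n w, forall x, x \in n -> adS x w = 0
    & forall t : subvs_of h, adS (vsval t) w = (la t : K) *: w].

Variables (U : algType K) (iota : {linear g -> U}).

Definition is_symmetrization (tau : S -> U) : Prop :=
  linear tau /\ forall x k, tau (sigma x ^+ k) = iota x ^+ k.

(* w = f_(k) *)
Definition represents_lead (B : S -> S -> K) (tau : S -> U) (f : U -> K)
    (k : nat) (w : S) : Prop :=
  Sgr k w /\ forall w', Sgr k w' -> B w w' = f (tau w').

End Symmetric.
End Lie.

(* Main.v *)
(** The functional f kills n U(g) and U(g) n, and h acts on it from the left by
    -nu_star and from the right by nu. Modulo shorter words, on which f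
    vanishes, f of a word of length k is symmetric in the letters; so f o tau
    kills (h + n) S^(k-1)(g), and since n is the Killing orthogonal of h + n,
    its representative lies in S(n). As tau intertwines the adjoint actions and
    the form on S(g) is ad-invariant, the representative inherits the
    n-invariance and the weight nu + nu_star of f.

    With dual bases (e_i), (d_i) for the Killing form, the representative of a
    functional F on S^k(g) is (1/k!) sum_I F(prod_j e_(I j)) prod_j d_(I j);
    everything about S^k(g) is checked on k-th powers, which span it. For
    f(1) = 0: otherwise nu + nu_star = 0, and z |-> f(z) is a linear form on g
    that kills [g, g], hence is 0, which forces nu = 0.

    Cartan's criterion is proved with weights. For e in the radical I of the
    Killing form, e of weight al and x of weight -al, put t = [e, x]; the trace
    of ad t vanishes on every al-string, so all roots take rational multiples of
    al(t) at t, and the Killing norm of t being 0 forces t = 0. An ideal J in I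
    with J = [J, J] is then spanned by vectors of nonzero weight, a set closed
    under brackets and consisting of ad-nilpotent elements, so J = 0 by the
    Engel-Jacobson argument. *)

From HB Require Import structures.
Require Import Defs.
From mathcomp Require Import all_boot all_order all_algebra.
From mathcomp Require Import boolp zify.

Set Implicit Arguments.
Unset Strict Implicit.
Unset Printing Implicit Defensive.

Import Order.TTheory GRing.Theory Num.Theory.
Local Open Scope ring_scope.

(** * Subspaces as propositional predicates, for induction along spanning sets *)

Definition lin_closed (K : fieldType) (M : lmodType K) (P : M -> Prop) :=
  P 0 /\ forall a x y, P x -> P y -> P (a *: x + y).

Section LinClosed.
Variables (K : fieldType) (M : lmodType K) (P : M -> Prop).
Hypothesis clP : lin_closed P.

Lemma lin_closedD x y : P x -> P y -> P (x + y).
Proof. by move=> Px Py; rewrite -[x]scale1r; apply: clP.2. Qed.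

Lemma lin_closedZ a x : P x -> P (a *: x).
Proof.
by move=> Px; rewrite -[_ *: x]addr0; apply: clP.2 => //; apply: clP.1.
Qed.

Lemma lin_closedB x y : P x -> P y -> P (x - y).
Proof. by move=> Px Py; rewrite addrC -scaleN1r; apply: clP.2. Qed.

Lemma lin_closed_sum (I : Type) (r : seq I) (Q : pred I) (F : I -> M) :
  (forall i, Q i -> P (F i)) -> P (\sum_(i <- r | Q i) F i).
Proof.
by move=> PF; elim/big_ind: _ => //; [apply: clP.1 | apply: lin_closedD].
Qed.

End LinClosed.

Lemma lin_closed_span (K : fieldType) (V : vectType K) (P : V -> Prop)
    (s : seq V) :
  lin_closed P -> (forall x, x \in s -> P x) -> forall x, x \in <<s>>%VS -> P x.
Proof.
move=> clP Ps x xs; rewrite (coord_span (X := in_tuple s) xs).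
apply: (lin_closed_sum clP) => i _; apply: (lin_closedZ clP); apply: Ps.
exact: mem_nth.
Qed.

Lemma lin_closed_vbasis (K : fieldType) (V : vectType K) (P : V -> Prop)
    (U : {vspace V}) :
  lin_closed P -> (forall x, x \in vbasis U -> P x) ->
  forall x, x \in U -> P x.
Proof.
move=> clP PU x xU; apply: (lin_closed_span clP PU).
by rewrite (span_basis (vbasisP U)).
Qed.

Lemma basis_of_subset (K : fieldType) (V : vectType K) (s : seq V) :
  exists2 s' : seq V, {subset s' <= s} & basis_of <<s>>%VS s'.
Proof.
elim: s => [|x s [s' ss' bs']].
  by exists [::]; rewrite // /basis_of eqxx nil_free.
have [xs|xs] := boolP (x \in <<s>>%VS).
  exists s'; first by move=> y /ss'; rewrite inE => ->; rewrite orbT.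
  suff -> : <<x :: s>>%VS = <<s>>%VS by [].
  by rewrite span_cons; apply/addv_idPr; rewrite -memvE.
exists (x :: s').
  by move=> y; rewrite !inE => /orP[->//|/ss' ->]; rewrite orbT.
rewrite /basis_of !span_cons (span_basis bs') eqxx free_cons.
rewrite (span_basis bs') xs.
exact: basis_free bs'.
Qed.

(* If two eigenvalues [c i] and [c j] occur in [x], then [f x - c i *: x] and
   [f x - c j *: x] have smaller support and span [x]. *)
Lemma diag_stable_ind (K : numFieldType) (V : vectType K) (f : 'End(V))
    (W : {vspace V}) (P : V -> Prop) :
  diagonalizable_end f -> (forall x, x \in W -> f x \in W) -> lin_closed P ->
  (forall x c, x \in W -> f x = c *: x -> P x) -> forall x, x \in W -> P x.
Proof.
move=> [e be fe] fW clP PW.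
pose X := in_tuple e; have freeX : free X := basis_free be.
have [c cP] : exists c : 'I_(size e) -> K,
    forall i : 'I_(size e), f X`_i = c i *: X`_i.
  apply: (@fin_all_exists 'I_(size e) (fun=> K)
    (fun i c => f X`_i = c *: X`_i)) => i.
  by apply: fe; apply: mem_nth.
have decX x : x = \sum_i coord X i x *: X`_i by apply: coord_basis (memvf x).
have cf x i : coord X i (f x) = c i * coord X i x.
  rewrite {1}[x]decX linear_sum /=.
  under eq_bigr do rewrite linearZ /= cP scalerA mulrC.
  by rewrite coord_sum_free.
move=> x; have [m] := ubnP #|[pred i | coord X i x != 0]|.
elim: m x => // m IHm x; rewrite ltnS => le_m xW.
have [/existsP[i /andP[xi0 /existsP[j /andP[xj0 cij]]]]|/existsPn same] :=
  boolP [exists i, (coord X i x != 0) &&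
    [exists j, (coord X j x != 0) && (c i != c j)]].
- have PT k : coord X k x != 0 -> P (f x - c k *: x).
    move=> xk0; apply: IHm; last by rewrite memvB ?memvZ ?fW.
    apply: leq_trans le_m; apply: proper_card; apply/properP; split.
      apply/subsetP => l; rewrite !inE linearB linearZ /= cf -mulrBl.
      by apply: contra_neq => ->; rewrite mulr0.
    by exists k; rewrite !inE ?xk0 // linearB linearZ /= cf subrr eqxx.
  have -> : x = (c j - c i)^-1 *: ((f x - c i *: x) - (f x - c j *: x)).
    have -> : (f x - c i *: x) - (f x - c j *: x) = (c j - c i) *: x.
      by rewrite scalerBl opprB addrC addrA subrK.
    by rewrite scalerK // subr_eq0 eq_sym.
  by apply: (lin_closedZ clP); apply: (lin_closedB clP); apply: PT.
have [i /= xi0|x0] := pickP [pred i | coord X i x != 0].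
  apply: (PW x (c i)) => //; rewrite [in LHS](decX x) [in RHS](decX x).
  rewrite linear_sum scaler_sumr; apply: eq_bigr => j _; rewrite linearZ /= cP.
  have := same i; rewrite xi0 => /existsPn/(_ j).
  have [->|_ /=] := eqVneq (coord X j x) 0; first by rewrite !scale0r scaler0.
  by rewrite negbK => /eqP->; rewrite !scalerA mulrC.
apply: (PW x 0) => //; rewrite [x]decX big1 ?linear0 ?scaler0 // => i _.
by have /negbFE/eqP-> := x0 i; rewrite scale0r.
Qed.

(** * Lie algebra basics and weights *)

Section LieBasics.
Variables (K : fieldType) (g : lieAlgType K).
Implicit Types (x y z : g) (I J W : {vspace g}).

Lemma liePl y a x x' : lie (a *: x + x') y = a *: lie x y + lie x' y.
Proof. exact: lie_linearl. Qed.

Lemma liePr x a y y' : lie x (a *: y + y') = a *: lie x y + lie x y'.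
Proof. exact: lie_linearr. Qed.

HB.instance Definition _ x :=
  GRing.isLinear.Build K g g *:%R (@lie K g x) (@lie_linearr K g x).

Lemma lieDl x x' y : lie (x + x') y = lie x y + lie x' y.
Proof. by rewrite -[x]scale1r liePl !scale1r. Qed.

Lemma lie0l y : lie (0 : g) y = 0.
Proof. by apply: (addrI (lie 0 y)); rewrite -lieDl !addr0. Qed.

Lemma lieZl a x y : lie (a *: x) y = a *: lie x y.
Proof. by rewrite -[a *: x]addr0 liePl lie0l !addr0. Qed.

Lemma lie0r x : lie x 0 = 0.
Proof. exact: linear0. Qed.

Lemma lieDr x y y' : lie x (y + y') = lie x y + lie x y'.
Proof. exact: linearD. Qed.

Lemma lieZr a x y : lie x (a *: y) = a *: lie x y.
Proof. exact: linearZ. Qed.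

Lemma lieC x y : lie x y = - lie y x.
Proof.
apply/eqP; rewrite -addr_eq0; have := lie_xx (x + y).
by rewrite lieDl !lieDr !lie_xx add0r addr0 => ->.
Qed.

Lemma lie_lie x y z : lie x (lie y z) = lie (lie x y) z + lie y (lie x z).
Proof.
have := lie_jacobi x y z; rewrite (lieC z (lie x y)) (lieC z x) => /eqP.
by rewrite linearN /= -addrA -opprD subr_eq0 addrC => /eqP.
Qed.

Lemma adE x y : ad x y = lie x y.
Proof. exact: (lfunE (lie x)). Qed.

Lemma ad_lie x y : ad (lie x y) = (ad x \o ad y)%VF - (ad y \o ad x)%VF.
Proof.
apply/lfunP => z; rewrite add_lfunE opp_lfunE !comp_lfunE !adE lie_lie.
by rewrite addrK.
Qed.

Lemma ad_linear : linear (@ad K g).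
Proof.
move=> a x y; apply/lfunP => z.
by rewrite add_lfunE scale_lfunE !adE liePl.
Qed.

Lemma liev_mem I J x y : x \in I -> y \in J -> lie x y \in liev I J.
Proof.
move=> xI yJ; move: y yJ; apply: lin_closed_vbasis => [|y yJ].
  by split=> [|a y y' ? ?]; rewrite ?lie0r ?mem0v ?liePr ?memvD ?memvZ.
move: x xI; apply: lin_closed_vbasis => [|x xI].
  by split=> [|a x x' ? ?]; rewrite ?lie0l ?mem0v ?liePl ?memvD ?memvZ.
by apply: memv_span; apply/allpairsP; exists (x, y).
Qed.

Lemma liev_ind I J (P : g -> Prop) : lin_closed P ->
  (forall x y, x \in I -> y \in J -> P (lie x y)) ->
  forall z, z \in liev I J -> P z.
Proof.
move=> clP PIJ; apply: lin_closed_span => // z /allpairsP[[x y] /= [xI yJ ->]].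
by apply: PIJ; apply: vbasis_mem.
Qed.

End LieBasics.

Section Weights.
Variables (K : numFieldType) (g : lieAlgType K) (h : {vspace g}).
Hypothesis h_cartan : cartan_subalgebra h.
Implicit Types (x y z : g) (W : {vspace g}) (al be : hform h).

Lemma h_abelian x y : x \in h -> y \in h -> lie x y = 0.
Proof. by have [ab _ _] := h_cartan; apply: ab. Qed.

(** Maximality of [h]: adjoining a vector that commutes with [h] keeps the sum abelian. *)
Lemma h_selfcentralizing x : (forall t, t \in h -> lie t x = 0) -> x \in h.
Proof.
have [_ maxh _] := h_cartan => xh; rewrite -(maxh (h + <[x]>)%VS) ?addvSl //.
  by rewrite memvE addvSr.
move=> y z /memv_addP[t th [_ /vlineP[a ->] ->]].
move=> /memv_addP[t' t'h [_ /vlineP[b ->] ->]].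
rewrite lieDl !lieDr !lieZl !lieZr (h_abelian th) // xh // lieC xh // lie_xx.
by rewrite oppr0 !scaler0 !addr0.
Qed.

Definition hstable W := forall t x, t \in h -> x \in W -> lie t x \in W.

(** Simultaneous diagonalization: [W] is cut by eigenspaces of the elements of a basis of [h], one
    after the other; these stay stable because [h] is abelian. *)
Lemma hstable_ind W (P : g -> Prop) : hstable W -> lin_closed P ->
  (forall al x, x \in W -> weight_vec al x -> P x) -> forall x, x \in W -> P x.
Proof.
have [_ _ dh] := h_cartan.
move=> hW clP PW.
suff key (ts : seq g) : {subset ts <= h} ->
    forall W', hstable W' -> (W' <= W)%VS ->
    (forall x, x \in W' ->
      (forall t, t \in ts -> exists c, lie t x = c *: x) -> P x) ->
    forall x, x \in W' -> P x.
  apply: (key (vbasis h)) => // [t|x xW xw]; first exact: vbasis_mem.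
  have {}xw t : t \in h -> exists c, lie t x = c *: x.
    move: t; apply: lin_closed_vbasis => //; split=> [|a t t' [c ct] [c' c't']].
      by exists 0; rewrite lie0l scale0r.
    by exists (a * c + c'); rewrite liePl ct c't' scalerDl scalerA.
  have [->|x0] := eqVneq x 0; first exact: clP.1.
  pose X := [tuple x]; have fX : free X by rewrite seq1_free.
  (* The weight is read off as the coordinate of [lie t x] along [x], which makes it linear in
     [t]. *)
  pose a (t : subvs_of h) : K^o := coord X ord0 (lie (vsval t) x).
  pose al := linfun a.
  apply: (PW al) => // t; have [c ct] := xw (vsval t) (subvsP t).
  rewrite /al.
  have lin : linear a.
    by move=> b u u'; rewrite /a linearP /= liePl linearP.
  pose L : {linear subvs_of h -> K^o} :=
    HB.pack a (GRing.isLinear.Build _ _ _ _ _ lin).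
  rewrite (lfunE L) /= /a ct linearZ /=; have := coord_free ord0 ord0 fX.
  by rewrite /= => ->; rewrite /= mulr1.
elim: ts => [|t ts IHts] tsh W' hW' sW' PW' x xW'.
  by apply: PW' => //.
move: x xW'.
have th : t \in h by apply: tsh; rewrite inE eqxx.
apply: (diag_stable_ind (dh t th)) => // [x|x c xW' tx].
  by rewrite adE; apply: hW'.
pose E := lker (ad t - c *: \1)%VF.
have memE y : y \in E = (lie t y == c *: y).
  by rewrite memv_ker add_lfunE opp_lfunE scale_lfunE id_lfunE adE subr_eq0.
apply: (IHts _ (W' :&: E)%VS); last by rewrite memv_cap xW' memE -adE tx eqxx.
- by move=> u uts; apply: tsh; rewrite inE uts orbT.
- move=> u y uh; rewrite !memv_cap !memE => /andP[yW' /eqP ty].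
  by rewrite hW' //= lie_lie (h_abelian th) // lie0l add0r ty lieZr.
- by rewrite (subv_trans (capvSl _ _)).
move=> y; rewrite memv_cap memE => /andP[yW' /eqP ty] yts; apply: PW' => // u.
by rewrite inE => /orP[/eqP->|/yts//]; exists c.
Qed.

Lemma weight_basis : exists (N : nat) (e : N.-tuple g) (be : 'I_N -> hform h),
  basis_of fullv e /\ forall i : 'I_N, weight_vec (be i) e`_i.
Proof.
have full_s x : exists2 s : seq g, x \in <<s>>%VS &
    forall y, y \in s -> exists al : hform h, weight_vec al y.
  have: x \in fullv by rewrite memvf.
  move: x; apply: hstable_ind => [t x _ _|//|al x _ xal].
  - by rewrite memvf.
  - split; first by exists [::] => //; rewrite mem0v.
    move=> a x y [s xs sP] [s' ys' s'P]; exists (s ++ s').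
      by rewrite span_cat memv_add // memvZ.
    by move=> z; rewrite mem_cat => /orP[/sP|/s'P].
  exists [:: x]; first by rewrite memv_span1.
  by move=> y; rewrite inE => /eqP->; exists al.
have full_l (l : seq g) : exists2 s : seq g, {subset l <= <<s>>%VS} &
    forall y, y \in s -> exists al : hform h, weight_vec al y.
  elim: l => [|x l [s ls sP]]; first by exists [::].
  have [s' xs' s'P] := full_s x; exists (s ++ s').
    move=> y; rewrite inE span_cat => /orP[/eqP->|/ls ys].
      by rewrite (subvP (addvSr _ _)).
    by rewrite (subvP (addvSl _ _)).
  by move=> z; rewrite mem_cat => /orP[/sP|/s'P].
have [s sP ws] := full_l (vbasis {:g}).
have [s' ss' bs'] := basis_of_subset s.
have fs : <<s>>%VS = fullv.
  apply/eqP; rewrite eqEsubv subvf -{1}(span_basis (vbasisP fullv)).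
  exact/span_subvP.
rewrite fs in bs'.
have [be beP] : exists be : 'I_(size s') -> hform h,
    forall i : 'I_(size s'), weight_vec (be i) s'`_i.
  apply: (@fin_all_exists 'I_(size s') (fun=> _)
    (fun i al => weight_vec al s'`_i)) => i.
  exact/ws/ss'/mem_nth.
by exists (size s'), (in_tuple s'), be.
Qed.
End Weights.

(** * Nondegeneracy of the Killing form *)

Section Trace.
Variables (K : fieldType) (V : vectType K).
Implicit Types (f g : 'End(V)).

(** Both sides are one double sum of products of matrix entries. Taking [g] the identity gives
    independence of the basis; taking a single basis gives cyclicity of the trace. *)
Lemma trace_swap n m (e : n.-tuple V) (e' : m.-tuple V) f g :
  basis_of fullv e -> basis_of fullv e' ->
  \sum_(i < n) coord e i (f (g e`_i)) = \sum_(j < m) coord e' j (g (f e'`_j)).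
Proof.
move=> be be'.
pose G (i : 'I_n) (j : 'I_m) := coord e' j (g e`_i) * coord e i (f e'`_j).
transitivity (\sum_i \sum_j G i j).
  apply: eq_bigr => i _.
  rewrite {1}(coord_basis be' (memvf (g _))) !linear_sum.
  by apply: eq_bigr => j _; rewrite !linearZ.
rewrite exchange_big; apply: eq_bigr => j _ /=.
rewrite [in RHS](coord_basis be (memvf (f _))) !linear_sum.
by apply: eq_bigr => i _; rewrite !linearZ /= mulrC.
Qed.

Lemma lfun_traceE n (e : n.-tuple V) f : basis_of fullv e ->
  lfun_trace f = \sum_(i < n) coord e i (f e`_i).
Proof.
move=> be; have := trace_swap f \1%VF (vbasisP fullv) be.
by under eq_bigr do rewrite id_lfunE; under [RHS]eq_bigr do rewrite id_lfunE.
Qed.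

Lemma lfun_traceC f g : lfun_trace (f \o g)%VF = lfun_trace (g \o f)%VF.
Proof.
have := trace_swap f g (vbasisP fullv) (vbasisP fullv).
under eq_bigr do rewrite -comp_lfunE.
by under [RHS]eq_bigr do rewrite -comp_lfunE.
Qed.

Lemma lfun_trace_linear : linear (@lfun_trace K V : 'End(V) -> K^o).
Proof.
move=> a f g; rewrite /lfun_trace linear_sum -big_split /=.
by apply: eq_bigr => i _; rewrite add_lfunE scale_lfunE linearP.
Qed.

Lemma lfun_traceB f g : lfun_trace (f - g) = lfun_trace f - lfun_trace g.
Proof.
by rewrite -scaleN1r addrC lfun_trace_linear /GRing.scale /= mulN1r addrC.
Qed.

End Trace.

Section Killing.
Variables (K : fieldType) (g : lieAlgType K).
Implicit Types (x y z : g).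

Lemma killingC x y : killing x y = killing y x.
Proof. exact: lfun_traceC. Qed.

Lemma killing_linearr x : linear (killing x : g -> K^o).
Proof.
move=> a y z; rewrite /killing ad_linear comp_lfunDr -comp_lfunZr.
exact: lfun_trace_linear.
Qed.

HB.instance Definition _ x :=
  GRing.isLinear.Build K g K^o *%R (killing x) (killing_linearr x).

Lemma killing_lie x y z : killing (lie x y) z = killing x (lie y z).
Proof.
rewrite /killing !ad_lie comp_lfunDl comp_lfunDr comp_lfunNl comp_lfunNr.
rewrite !lfun_traceB.
rewrite !comp_lfunA; congr (_ - _).
by rewrite -[X in lfun_trace X = _]comp_lfunA lfun_traceC.
Qed.

End Killing.

Section Semisimple.
Variables (K : numFieldType) (g : lieAlgType K) (h : {vspace g}).
Hypothesis g_ss : semisimple_alg g.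
Hypothesis h_cartan : cartan_subalgebra h.
Implicit Types (x y z : g) (W : {vspace g}) (al be : hform h).

(** A central vector spans an abelian ideal. *)
Lemma central_eq0 x : (forall y, lie x y = 0) -> x = 0.
Proof.
move=> xc; apply/eqP; rewrite -memv0 -(g_ss (I := <[x]>%VS)) ?memv_line //.
  split=> [|y z _ /vlineP[a ->]]; first exact: subvf.
  by rewrite lieZr lieC xc oppr0 scaler0 mem0v.
exists 1%N; apply/eqP; rewrite -subv0; apply/subvP => z.
apply: (liev_ind (P := fun z => z \in 0%VS)).
  by split=> [|a u v ? ?]; rewrite ?mem0v ?memvD ?memvZ.
by move=> u v /vlineP[a ->] _; rewrite lieZl xc scaler0 mem0v.
Qed.

Lemma weight_vec_lie al be x y :
  weight_vec al x -> weight_vec be y -> weight_vec (al + be) (lie x y).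
Proof.
by move=> xal ybe t; rewrite lie_lie xal ybe lieZl lieZr add_lfunE scalerDl.
Qed.

Lemma weight0_mem x : weight_vec (0 : hform h) x -> x \in h.
Proof.
move=> x0; apply: h_selfcentralizing => // t th.
have := x0 (vsproj h t); rewrite vsprojK // => ->.
by rewrite zero_lfunE scale0r.
Qed.

Section WeightBasis.
Variables (N : nat) (e : N.-tuple g) (be : 'I_N -> hform h).
Hypothesis basis_e : basis_of fullv e.
Hypothesis weight_e : forall i : 'I_N, weight_vec (be i) e`_i.

(** Bracketing with [t] multiplies the coordinate of index [i] by [be i t], but also by [al t]. *)
Lemma weight_vec_coord al x i : weight_vec al x -> coord e i x != 0 -> be i = al.
Proof.
move=> xal; apply: contraNeq => /lfunPn[t bt].
have : coord e i (lie (vsval t) x) = be i t * coord e i x.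
  rewrite {1}(coord_basis basis_e (memvf x)) linear_sum /=.
  under eq_bigr do rewrite linearZ /= weight_e scalerA mulrC.
  by rewrite coord_sum_free ?(basis_free basis_e).
rewrite xal linearZ /= => /eqP; rewrite -subr_eq0 -mulrBl mulf_eq0 subr_eq0 eq_sym.
by rewrite (negPf bt).
Qed.

Lemma lin_closed_basis (P : g -> Prop) : lin_closed P ->
  (forall i : 'I_N, P e`_i) -> forall x, P x.
Proof.
move=> clP Pe x; apply: (lin_closed_span (s := e) clP).
  by move=> y /tnthP[i ->]; rewrite (tnth_nth 0).
by rewrite (span_basis basis_e) memvf.
Qed.

Lemma coord_e (i j : 'I_N) : coord e i e`_j = (i == j)%:R.
Proof. by rewrite coord_free ?(basis_free basis_e) // eq_sym. Qed.

(* For [p] the set of indices of an [al]-string, the sum is the trace of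
   [ad (lie x y)] on that string; it vanishes since the projection onto the
   string commutes with [ad x]. *)
Lemma string_trace al x y (p : pred 'I_N) (t : subvs_of h) :
  weight_vec al x -> weight_vec (- al) y -> vsval t = lie x y ->
  (forall i j, be j = al + be i -> p i = p j) ->
  \sum_(i | p i) be i t = 0.
Proof.
move=> xal yal txy pal.
pose F z := \sum_(i | p i) coord e i z *: e`_i.
have linF : linear F.
  move=> a u v; rewrite scaler_sumr -big_split; apply: eq_bigr => i _ /=.
  by rewrite linearP scalerDl scalerA.
pose LF : {linear g -> g} := HB.pack F (GRing.isLinear.Build _ _ _ _ F linF).
pose Q := linfun LF.
have QE z : Q z = F z by rewrite lfunE.
have Qe (i : 'I_N) : Q e`_i = (p i)%:R *: e`_i.
  rewrite QE /F; case: (boolP (p i)) => pi.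
    rewrite (bigD1 i) //= coord_e eqxx big1 ?addr0 // => j /andP[_ ji].
    by rewrite coord_e (negPf ji) scale0r.
  rewrite big1 ?scale0r // => j pj; rewrite coord_e.
  by have [ji|] := eqVneq j i; [rewrite -ji pj in pi | rewrite scale0r].
have QX : (Q \o ad x = ad x \o Q)%VF.
  suff H z : Q (lie x z) = lie x (Q z).
    by apply/lfunP => z; rewrite !comp_lfunE !adE.
  move: z; apply: lin_closed_basis => [|i].
    split=> [|a u v IHu IHv]; first by rewrite lie0r linear0 lie0r.
    by rewrite liePr !linearP /= IHu IHv.
  rewrite Qe lieZr QE /F.
  rewrite [in RHS](coord_basis basis_e (memvf (lie x e`_i))) scaler_sumr.
  rewrite big_mkcond.
  apply: eq_bigr => j _.
  have [->|cj] := eqVneq (coord e j (lie x e`_i)) 0.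
    by rewrite scale0r scaler0; case: ifP.
  (* A basis vector occurring in [lie x e_i] has weight [al + be i], so its index satisfies [p]
     exactly when [i] does. *)
  rewrite (pal i j) ?(weight_vec_coord (weight_vec_lie xal (weight_e i)) cj) //.
  by case: ifP; rewrite ?scale1r ?scale0r.
have: lfun_trace (Q \o ad (vsval t))%VF = 0.
  rewrite txy ad_lie comp_lfunDr comp_lfunNr lfun_traceB.
  apply/eqP; rewrite subr_eq0; apply/eqP.
  transitivity (lfun_trace (ad x \o (Q \o ad y))%VF).
    by rewrite !comp_lfunA QX.
  by rewrite [LHS]lfun_traceC comp_lfunA.
rewrite (lfun_traceE _ basis_e) => trQ; rewrite -[RHS]trQ big_mkcond.
apply: eq_bigr => i _; rewrite comp_lfunE adE weight_e linearZ /= Qe !linearZ /=.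
by rewrite coord_e eqxx; case: ifP; rewrite ?mulr1 ?mulr0.
Qed.

Lemma killing_on_h (s t : subvs_of h) :
  killing (vsval s) (vsval t) = \sum_i be i s * be i t.
Proof.
rewrite /killing (lfun_traceE _ basis_e); apply: eq_bigr => i _.
rewrite comp_lfunE !adE weight_e lieZr weight_e !linearZ /= coord_e eqxx.
by rewrite mulr1 mulrC.
Qed.

(* On the [al]-string through a root [be i] the trace of [ad t] vanishes, so
   [be i t] is a rational multiple of [al t], and then [killing t t = 0]
   forces every [be i t] to be zero. *)
Lemma radical_lie_opp al x y : (forall z, killing x z = 0) ->
  weight_vec al x -> weight_vec (- al) y -> lie x y = 0.
Proof.
move=> xrad xal yal; set t0 := lie x y.
have t0h : t0 \in h.
  by apply: weight0_mem; rewrite -(subrr al); apply: weight_vec_lie.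
have [t tE] : exists t : subvs_of h, vsval t = t0.
  by exists (vsproj h t0); rewrite vsprojK.
have ratio i0 : exists q : rat, be i0 t = ratr q * al t.
  (* The indices of the [al]-string through [be i0]. *)
  pose p i := `[< exists k : int, be i = be i0 + al *~ k >].
  have pP i : p i -> exists k : int, be i = be i0 + al *~ k by move/asboolP.
  have p_i0 : p i0 by apply/asboolP; exists 0; rewrite mulr0z addr0.
  have /(string_trace xal yal tE) : forall i j, be j = al + be i -> p i = p j.
    move=> i j ij; apply/asboolP/asboolP => -[k bk].
      by exists (k + 1); rewrite ij bk mulrzDr mulr1z addrC addrA.
    exists (k - 1); rewrite mulrzBr mulr1z addrA -bk ij.
    by rewrite addrC addKr.
  have [k kP] : exists k : 'I_N -> int,
      forall i, p i -> be i = be i0 + al *~ k i.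
    apply: (@fin_all_exists 'I_N (fun=> int)
      (fun i k => p i -> be i = be i0 + al *~ k)) => i.
    by case: (boolP (p i)) => [/pP[k kP]|_]; [exists k | exists 0].
  pose n := #|p|; have n0 : (n%:R : K) != 0.
    by rewrite pnatr_eq0 -lt0n; apply/card_gt0P; exists i0.
  under eq_bigr => i pi do rewrite (kP i pi) add_lfunE -scaler_int scale_lfunE.
  rewrite big_split /= sumr_const -/n -scaler_suml => /eqP.
  rewrite addr_eq0 => /eqP E.
  exists (- (\sum_(i | p i) k i)%:~R / n%:R).
  apply: (mulfI n0); rewrite mulr_natl E fmorph_div rmorphN /= ratr_int ratr_nat.
  by rewrite mulrA mulrCA mulfV // mulr1 raddf_sum /= mulNr.
have bt0 i : be i t = 0.
  have [al0|al0] := eqVneq (al t) 0.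
    by have [q ->] := ratio i; rewrite al0 mulr0.
  (* Division by [al t] turns the summands into squares of rationals, which are nonnegative in [K];
     squares of the [be i t] themselves need not be. *)
  have : \sum_i (be i t / al t) ^+ 2 = 0.
    have : killing (vsval t) (vsval t) = 0 by rewrite {1}tE killing_lie.
    rewrite killing_on_h => kt.
    rewrite -[RHS](mul0r (al t ^- 2)) -[in RHS]kt mulr_suml.
    by apply: eq_bigr => j _; rewrite expr_div_n -expr2.
  move/psumr_eq0P => H.
  have /eqP : (be i t / al t) ^+ 2 = 0.
    apply: H => // j _; have [q ->] := ratio j; rewrite mulfK //.
    by rewrite real_exprn_even_ge0 // ; apply: rpred_rat.
  by rewrite expf_eq0 /= mulf_eq0 invr_eq0 (negPf al0) orbF => /eqP.
(* All weights vanish at [t], so [t] is central. *)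
rewrite -/t0 -tE; apply: central_eq0; apply: lin_closed_basis => [|i].
  by split=> [|a u v IHu IHv]; rewrite ?lie0r // liePr IHu IHv scaler0 addr0.
by rewrite weight_e bt0 scale0r.
Qed.

End WeightBasis.
End Semisimple.

Lemma ltn_dim_add_line (K : fieldType) (V : vectType K) (U : {vspace V}) x :
  x \notin U -> (\dim U < \dim (U + <[x]>)%VS)%N.
Proof.
rewrite ltnNge; apply: contra => le_d.
have /eqP -> : (U == U + <[x]>)%VS by rewrite eqEdim addvSl.
by rewrite memvE addvSr.
Qed.

(** * The Engel-Jacobson argument for a bracket-closed set of ad-nilpotent elements *)

Section EngelJacobson.
Variables (K : fieldType) (g : lieAlgType K) (J : {vspace g}) (Wp : g -> Prop).
Hypothesis Wp_J : forall x, Wp x -> x \in J.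
Hypothesis Wp_lie : forall x y, Wp x -> Wp y -> Wp (lie x y).
Hypothesis Wp_span : forall U : {vspace g},
  (forall x, Wp x -> x \in U) -> (J <= U)%VS.
Hypothesis Wp_nil : forall z x, Wp z -> exists m, iter m (lie z) x = 0.
Implicit Types (A M : {vspace g}).

Let stable A M := forall a x, a \in A -> x \in M -> lie a x \in M.

(* [C] records that the vector annihilated modulo [M] is reached from [v0] by
   bracketing with elements of [Wp]; with [v0] in [Wp] it stays in [Wp]. *)
Let annihilating A := forall M (C : g -> Prop) v0, stable A M ->
  C v0 -> (forall w x, Wp w -> C x -> C (lie w x)) -> v0 \notin M ->
  exists v, [/\ C v, v \notin M & forall a, a \in A -> lie a v \in M].

(** A vector annihilated by [A] modulo [M] is moved by [lie z] until the next step would enter [M].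
    As [lie z] normalizes [A] and preserves [M], every iterate is still annihilated by [A] modulo
    [M]. *)
Lemma annihilating_extend A z : subalgebra A -> annihilating A -> Wp z ->
  (forall a, a \in A -> lie a z \in A) -> annihilating (A + <[z]>)%VS.
Proof.
move=> sA annA Wz zA M C v0 stM Cv0 CW v0M.
have stA : stable A M.
  by move=> a x aA; apply: stM; rewrite (subvP (addvSl _ _)).
have stz x : x \in M -> lie z x \in M.
  by apply: stM; rewrite (subvP (addvSr _ _)) ?memv_line.
have [v [Cv vM Av]] := annA M C v0 stA Cv0 CW v0M.
have C_iter m : C (iter m (lie z) v) by elim: m => //= m; apply: CW.
have A_iter m a : a \in A -> lie a (iter m (lie z) v) \in M.
  elim: m a => [|m IHm] a aA /=; first exact: Av.
  by rewrite lie_lie memvD ?IHm ?zA ?stz ?IHm.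
have [m0 iter0] := Wp_nil v Wz.
have exM : exists m, iter m (lie z) v \in M by exists m0; rewrite iter0 mem0v.
(* The first exponent landing in [M] is positive because [v] is outside [M]; its predecessor gives
   the vector sought. *)
have [[|m] mM minm] := ex_minnP exM; first by rewrite /= (negPf vM) in mM.
exists (iter m (lie z) v); split=> //.
  by apply/negP => /minm; rewrite ltnn.
move=> _ /memv_addP[a aA [_ /vlineP[c ->] ->]].
by rewrite lieDl lieZl memvD ?A_iter ?memvZ.
Qed.

(** The property is carried from the zero subalgebra up to [J], one line at a time. *)
Lemma annihilating_ideal : annihilating J.
Proof.
suff H A : (A <= J)%VS -> subalgebra A -> annihilating A -> annihilating J.
  apply: (H 0%VS); rewrite ?sub0v //.
    by move=> x y /[!memv0] /eqP-> _; rewrite lie0l.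
  move=> M C v0 _ Cv0 _ v0M; exists v0; split=> // a /[!memv0] /eqP->.
  by rewrite lie0l mem0v.
have [m] := ubnP (\dim J - \dim A); elim: m A => // m IHm A.
rewrite ltnS => le_m AJ sA annA.
have [JA|nJA] := boolP (J <= A)%VS.
  by suff -> : J = A by []; apply/eqP; rewrite eqEsubv JA AJ.
have [y0 Wy0 y0A] : exists2 y, Wp y & y \notin A.
  apply: contrapT => /forall2NP H; case/negP: nJA; apply: Wp_span => x Wx.
  by case: (H x) => // /negP; rewrite negbK.
(* Applied with [M := A], the property of [A] yields an element of [Wp] outside [A] that normalizes
   [A]. *)
have [z [Wz zA Az]] := annA A Wp y0 sA Wy0 Wp_lie y0A.
have leA : (A + <[z]> <= J)%VS by rewrite subv_add AJ -memvE Wp_J.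
apply: (IHm (A + <[z]>)%VS) => //.
- have := ltn_dim_add_line zA; have := dimvS leA; move: le_m; lia.
- move=> _ _ /memv_addP[a aA [_ /vlineP[c ->] ->]]
    /memv_addP[b bA [_ /vlineP[d ->] ->]].
  rewrite lieDl !lieDr !lieZl !lieZr lie_xx (lieC z) !scaler0 addr0.
  rewrite (subvP (addvSl _ _)) //.
  apply: memvD; last by apply: memvZ; rewrite memvN Az.
  by apply: memvD; [exact: sA | exact/memvZ/Az].
by apply: annihilating_extend.
Qed.

(** Every [J]-stable subspace [M] of [J] equals [J], by induction on codimension: a proper [M]
    extends by some [v] in [Wp] with [[J, v]] inside [M]; by induction [J = M + <v>], so [[J, J]],
    which contains [J], lies in [M]. The case [M = 0] concludes. *)
Lemma perfect_eq0 : subalgebra J -> (J <= liev J J)%VS -> J = 0%VS.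
Proof.
move=> sJ perfJ; apply/eqP; rewrite -subv0.
suff H M : (M <= J)%VS -> stable J M -> (J <= M)%VS.
  by apply: H; rewrite ?sub0v // => a x _ /[!memv0] /eqP->; rewrite lie0r.
have [m] := ubnP (\dim J - \dim M); elim: m M => // m IHm M.
rewrite ltnS => le_m MJ stM; apply: contraT => nJM.
have [v0 Wv0 v0M] : exists2 y, Wp y & y \notin M.
  apply: contrapT => /forall2NP H; case/negP: nJM; apply: Wp_span => x Wx.
  by case: (H x) => // /negP; rewrite negbK.
have [v [Wv vM Jv]] := annihilating_ideal stM Wv0 Wp_lie v0M.
have leM : (M + <[v]> <= J)%VS by rewrite subv_add MJ -memvE Wp_J.
have JMv a x : a \in J -> x \in (M + <[v]>)%VS -> lie a x \in M.
  move=> aJ /memv_addP[b bM [_ /vlineP[d ->] ->]].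
  by rewrite lieDr lieZr; apply: memvD; [exact: stM | exact/memvZ/Jv].
have JM : (J <= M + <[v]>)%VS.
  apply: IHm => //; last first.
    by move=> a x aJ /(JMv a x aJ); apply: (subvP (addvSl _ _)).
  have := ltn_dim_add_line vM; have := dimvS leM; move: le_m; lia.
case/negP: nJM; apply: (subv_trans perfJ); apply/subvP; apply: liev_ind.
  by split=> [|a x y ? ?]; rewrite ?mem0v ?memvD ?memvZ.
by move=> x y xJ yJ; apply: JMv => //; apply: (subvP JM).
Qed.

End EngelJacobson.

(** * Vanishing of the radical of the Killing form *)

Section Radical.
Variables (K : numFieldType) (g : lieAlgType K) (h : {vspace g}).
Hypothesis g_ss : semisimple_alg g.
Hypothesis h_cartan : cartan_subalgebra h.
Implicit Types (x y z : g) (I J W : {vspace g}) (al be : hform h).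

Lemma ideal_hstable I : ideal_of fullv I -> hstable h I.
Proof. by case=> _ idI t x _ xI; apply: idI; rewrite ?memvf. Qed.

Lemma liev_sub I J W : (forall x y, x \in I -> y \in J -> lie x y \in W) ->
  (liev I J <= W)%VS.
Proof.
move=> sW; apply/subvP; apply: liev_ind => //.
by split=> [|a x y ? ?]; rewrite ?mem0v ?memvD ?memvZ.
Qed.

(** If no iterate on [e_i] vanished, the weights [be i + m al], pairwise distinct in characteristic
    zero, would all occur among the [N] weights of the basis. *)
Lemma weight_ad_nilpotent al z x : al != 0 -> weight_vec al z ->
  exists m, iter m (lie z) x = 0.
Proof.
move=> al0 zal.
have [N [e [be [basis_e weight_e]]]] := weight_basis h_cartan.
move: x; apply: (lin_closed_basis basis_e) => [|i].
  have iter0 m : iter m (lie z) 0 = 0 by elim: m => //= m ->; rewrite lie0r.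
  have iterP m a u v : iter m (lie z) (a *: u + v) =
      a *: iter m (lie z) u + iter m (lie z) v.
    by elim: m => //= m ->; rewrite liePr.
  split=> [|a u v [m um] [m' vm']]; first by exists 0%N.
  exists (m + m')%N; rewrite iterP [in X in _ *: X]addnC !iterD um vm' !iter0.
  by rewrite scaler0 addr0.
have witer m : weight_vec (be i + al *+ m) (iter m (lie z) e`_i).
  elim: m => [|m IHm] /=; first by rewrite addr0.
  by rewrite mulrS addrCA; apply: weight_vec_lie.
apply: contrapT => /forallNP iter_neq0.
have ex_k (m : 'I_N.+1) : exists k : 'I_N, be k = be i + al *+ m.
  have [k ck|c0] := pickP (fun k => coord e k (iter m (lie z) e`_i) != 0).
    by exists k; apply: (weight_vec_coord basis_e weight_e (witer m) ck).
  case: (iter_neq0 m).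
  rewrite [LHS](coord_basis basis_e (memvf _)) big1 // => k _.
  by have /negbFE/eqP-> := c0 k; rewrite scale0r.
have [k kP] := fin_all_exists ex_k.
have k_inj : injective k.
  move=> m m' /(congr1 be); rewrite !kP => /addrI/eqP.
  rewrite -!scaler_nat -subr_eq0 -scalerBl scaler_eq0 (negPf al0) orbF subr_eq0.
  by rewrite eqr_nat => /eqP/val_inj.
by have := leq_card k k_inj; rewrite !card_ord ltnn.
Qed.

Lemma killing_radical_eq0 x0 : (forall z, killing x0 z = 0) -> x0 = 0.
Proof.
have [N [e [be [basis_e weight_e]]]] := weight_basis h_cartan.
pose F z := \sum_(i < N) killing z e`_i *: e`_i.
have linF : linear F.
  move=> a u v; rewrite scaler_sumr -big_split; apply: eq_bigr => i _ /=.
  by rewrite !(killingC _ e`_i) killing_linearr scalerDl scalerA.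
pose LF : {linear g -> g} := HB.pack F (GRing.isLinear.Build _ _ _ _ F linF).
pose I := lker (linfun LF).
have memI z : z \in I <-> forall y, killing z y = 0.
  rewrite memv_ker lfunE /= /F; split=> [/eqP F0|z0].
    apply: (lin_closed_basis basis_e) => [|i].
      split=> [|a u v IHu IHv]; last first.
        by rewrite killing_linearr IHu IHv scaler0 addr0.
      exact: (raddf0 (killing z : {additive g -> K^o})).
    have := congr1 (coord e i) F0.
    by rewrite linear0 coord_sum_free ?(basis_free basis_e).
  by apply/eqP; rewrite big1 // => i _; rewrite z0 scale0r.
move=> /memI; suff -> : I = 0%VS by rewrite memv0 => /eqP.
have idI : ideal_of fullv I.
  split=> [|y z _ /memI z0]; first exact: subvf.
  by apply/memI => u; rewrite killingC -killing_lie killingC.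
(* Induction on dimension over the ideals contained in the radical [I]. *)
suff H J : (J <= I)%VS -> ideal_of fullv J -> J = 0%VS.
  by apply: H; rewrite ?subvv.
have [m] := ubnP (\dim J); elim: m J => // m IHm J; rewrite ltnS => le_m JI idJ.
have sJ : subalgebra J by move=> x y _ yJ; apply: idJ.2; rewrite ?memvf.
have J'J : (liev J J <= J)%VS by apply: liev_sub.
have idJ' : ideal_of fullv (liev J J).
  split=> [|x z _]; first exact: subvf.
  move: z; apply: liev_ind => [|y z yJ zJ].
    by split=> [|a y z ? ?]; rewrite ?lie0r ?mem0v // liePr memvD ?memvZ.
  by rewrite lie_lie memvD ?liev_mem // idJ.2 ?memvf.
have [perfJ|nperf] := boolP (J <= liev J J)%VS; last first.
  (* Here [[J, J]] is smaller than [J], hence zero by induction, and [J] is abelian. *)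
  apply: g_ss idJ _; exists 1%N; apply: IHm idJ'; last exact: subv_trans JI.
  apply: leq_trans le_m; rewrite ltnNge; apply: contra nperf => le_d.
  by have /eqP -> : (liev J J == J)%VS by rewrite eqEdim J'J.
pose Wp x := x \in J /\
  (x = 0 \/ exists2 al : hform h, al != 0 & weight_vec al x).
have Wp_lie x y : Wp x -> Wp y -> Wp (lie x y).
  move=> [xJ Wx] [yJ Wy]; split; first exact: sJ.
  case: Wx => [->|[al al0 xal]]; first by left; rewrite lie0l.
  case: Wy => [->|[al' al'0 yal']]; first by left; rewrite lie0r.
  have [/eqP|al_al'] := eqVneq (al + al') 0; last first.
    by right; exists (al + al') => //; apply: weight_vec_lie.
  rewrite addrC addr_eq0 => /eqP al'E; left.
  apply: (radical_lie_opp g_ss h_cartan basis_e weight_e _ xal).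
    by apply/memI; apply: (subvP JI).
  by rewrite -al'E.
have hJ := ideal_hstable idJ.
apply: (@perfect_eq0 _ _ J Wp) => // [x [] //|U WU|z x [_ [->|[al al0 zal]]]].
(* As [J = [J, J]], brackets of weight vectors of [J] span it, and those of total weight zero
   vanish. *)
- apply: (subv_trans perfJ); apply: liev_sub => x y xJ.
  move: y; apply: (hstable_ind h_cartan hJ) => [|al y yJ yal].
    by split=> [|a u v ? ?]; rewrite ?lie0r ?mem0v // liePr memvD ?memvZ.
  move: x xJ; apply: (hstable_ind h_cartan hJ) => [|al' x xJ xal'].
    by split=> [|a u v ? ?]; rewrite ?lie0l ?mem0v // liePl memvD ?memvZ.
  apply: WU; split; first exact: sJ.
  have [/eqP|al'_al] := eqVneq (al' + al) 0; last first.
    by right; exists (al' + al) => //; apply: weight_vec_lie.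
  rewrite addrC addr_eq0 => /eqP alE; left.
  apply: (radical_lie_opp g_ss h_cartan basis_e weight_e _ xal').
    by apply/memI; apply: (subvP JI).
  by rewrite -alE.
- by exists 1%N; rewrite /= lie0l.
exact: weight_ad_nilpotent al0 zal.
Qed.

End Radical.

Section KillingLinear.
Variables (K : fieldType) (g : lieAlgType K).
Implicit Types (x y z : g).

Lemma killingPr a x y z : killing x (a *: y + z) = a * killing x y + killing x z.
Proof. exact: killing_linearr. Qed.

Lemma killingPl a x y z : killing (a *: y + z) x = a * killing y x + killing z x.
Proof. by rewrite !(killingC _ x) killingPr. Qed.

Lemma killingDl x y z : killing (y + z) x = killing y x + killing z x.
Proof. by rewrite -[y]scale1r killingPl mul1r scale1r. Qed.

Lemma killing0r x : killing x 0 = 0.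
Proof. exact: (raddf0 (killing x : {additive g -> K^o})). Qed.

Lemma killing0l x : killing 0 x = 0.
Proof. by rewrite killingC killing0r. Qed.

Lemma killingZl a x y : killing (a *: x) y = a * killing x y.
Proof. by rewrite -[a *: x]addr0 killingPl killing0l addr0. Qed.

Lemma killingNl x y : killing (- x) y = - killing x y.
Proof. by rewrite -scaleN1r killingZl mulN1r. Qed.

Lemma killing_sumZr (I : finType) x (c : I -> K) (u : I -> g) :
  killing x (\sum_i c i *: u i) = \sum_i c i * killing x (u i).
Proof.
rewrite (raddf_sum (killing x : {additive g -> K^o})); apply: eq_bigr => i _.
by rewrite /= killingC killingZl killingC.
Qed.

Lemma killing_perp_closed x : lin_closed (fun y => killing x y = 0).
Proof.
by split=> [|a y z IHy IHz]; rewrite ?killing0r // killingPr IHy IHz mulr0 addr0.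
Qed.

End KillingLinear.

(** * Dual bases adapted to the triangular decomposition *)

Section HStableComplement.
Variables (K : numFieldType) (g : lieAlgType K) (h : {vspace g}).
Hypothesis h_cartan : cartan_subalgebra h.
Variable W : {vspace g}.
Hypothesis hW : hstable h W.
Hypothesis Wh0 : (W :&: h = 0)%VS.

(** A vector of weight zero lies in [h], so the only one in [W] is zero. *)
Lemma hstable_off_ind (P : g -> Prop) : lin_closed P ->
  (forall (al : hform h) (s : subvs_of h) x,
    x \in W -> weight_vec al x -> al s != 0 -> P x) ->
  forall x, x \in W -> P x.
Proof.
move=> clP PW; apply: (hstable_ind h_cartan hW) => // al x xW xal.
have [al0|] := eqVneq al 0; last first.
  by move=> /lfunPn[s]; rewrite zero_lfunE => /PW; apply.
suff -> : x = 0 by apply: clP.1.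
apply/eqP; rewrite -memv0 -Wh0 memv_cap xW (weight0_mem h_cartan) //.
by rewrite -al0.
Qed.

(** For [x] of weight [al], multiplying the pairing by [al s] replaces [x] by [lie s x]; invariance
    then brings together two elements of the abelian [h]. *)
Lemma killing_hstable_h x t : x \in W -> t \in h -> killing x t = 0.
Proof.
move=> + th; move: x; apply: hstable_off_ind.
  by split=> [|a x y IHx IHy]; rewrite ?killing0l // killingPl IHx IHy mulr0 addr0.
move=> al s x _ xal als; apply: (mulfI als).
rewrite -killingZl -xal lieC killingNl killing_lie.
rewrite (h_abelian h_cartan) ?subvsP //.
by rewrite killing0r oppr0 mulr0.
Qed.

(** The same device leads to the pairing of [s] with [lie x y], an element of [W] and so orthogonal
    to [h]. *)
Lemma killing_hstable x y : subalgebra W -> x \in W -> y \in W -> killing x y = 0.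
Proof.
move=> sW + yW; move: x; apply: hstable_off_ind.
  by split=> [|a x z IHx IHz]; rewrite ?killing0l // killingPl IHx IHz mulr0 addr0.
move=> al s x xW xal als; apply: (mulfI als).
rewrite -killingZl -xal killing_lie killingC.
by rewrite killing_hstable_h ?subvsP ?sW ?mulr0.
Qed.

End HStableComplement.

Section Triangular.
Variables (K : numFieldType) (g : lieAlgType K) (nm h n : {vspace g}).
Hypothesis g_ss : semisimple_alg g.
Hypothesis tri : triangular_decomposition nm h n.
Implicit Types (x y z : g).

Lemma tri_cartan : cartan_subalgebra h. Proof. by case: tri. Qed.
Let h_cartan := tri_cartan.

Lemma nilradical_hstable (b W : {vspace g}) :
  nilradical_of b W -> (h <= b)%VS -> hstable h W.
Proof. by move=> [[_ idW] _ _] /subvP hb t x th; apply: idW; apply: hb. Qed.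

Lemma nilradical_subalgebra (b W : {vspace g}) : nilradical_of b W -> subalgebra W.
Proof. by move=> [[/subvP Wb idW] _ _] x y xW; apply: idW; apply: Wb. Qed.

Lemma tri_n_hstable : hstable h n.
Proof.
by case: tri => _ [_ nr] _ _ _; apply: nilradical_hstable nr (addvSl _ _).
Qed.

Lemma tri_nm_hstable : hstable h nm.
Proof.
by case: tri => _ _ [_ nr] _ _; apply: nilradical_hstable nr (addvSl _ _).
Qed.

Lemma tri_n_subalgebra : subalgebra n.
Proof. by case: tri => _ [_ nr] _ _ _; apply: nilradical_subalgebra nr. Qed.

Lemma tri_nm_subalgebra : subalgebra nm.
Proof. by case: tri => _ _ [_ nr] _ _; apply: nilradical_subalgebra nr. Qed.

Lemma tri_cap : (nm :&: h = 0)%VS /\ (n :&: h = 0)%VS.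
Proof.
case: tri => _ _ _ + _.
rewrite directv_addE /= => /and3P[/directv_addP nmh _ /eqP nn].
split=> //; apply/eqP; rewrite -subv0 -nn subv_cap capvSl.
by rewrite (subv_trans (capvSr _ _)) // addvSr.
Qed.

Lemma tri_decomp x : exists y t z, [/\ y \in nm, t \in h, z \in n & x = y + t + z].
Proof.
have : x \in (nm + h + n)%VS by case: tri => _ _ _ _ ->; rewrite memvf.
move=> /memv_addP[_ /memv_addP[y yn [t th ->]] [z zn ->]].
by exists y, t, z.
Qed.

(** By the orthogonality relations, pairing [x] with [h] isolates its [h]-component, and pairing
    with [n] then isolates its [nm]-component; nondegeneracy kills both. *)
Lemma perp_borel_n x : (forall y, y \in (h + n)%VS -> killing x y = 0) -> x \in n.
Proof.
move=> xb; have [nmh nh] := tri_cap.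
have [y [t [z [ynm th zn xE]]]] := tri_decomp x.
have kD u : killing x u = killing y u + killing t u + killing z u.
  by rewrite xE !killingDl.
have nmK := killing_hstable h_cartan tri_nm_hstable nmh.
have nmhK := killing_hstable_h h_cartan tri_nm_hstable nmh.
have nK := killing_hstable h_cartan tri_n_hstable nh.
have nhK := killing_hstable_h h_cartan tri_n_hstable nh.
have perp_eq0 u : (forall w, w \in nm -> killing u w = 0) ->
    (forall w, w \in h -> killing u w = 0) ->
    (forall w, w \in n -> killing u w = 0) -> u = 0.
  move=> unm uh un; apply: (killing_radical_eq0 g_ss h_cartan) => w.
  have [y' [t' [z' [? ? ? ->]]]] := tri_decomp w.
  by rewrite -addrA; do ?[apply: (lin_closedD (killing_perp_closed u))]; auto.
have t0 : t = 0.
  apply: perp_eq0 => w wW; rewrite killingC; [exact: nmhK| |exact: nhK].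
  have := xb w; rewrite kD (nmhK y) // (nhK z) // add0r addr0 killingC; apply.
  by rewrite (subvP (addvSl _ _)).
have y0 : y = 0.
  apply: perp_eq0 => w wW; [exact: nmK tri_nm_subalgebra _ _|exact: nmhK|].
  have := xb w; rewrite kD t0 killing0l (nK z w tri_n_subalgebra) // !addr0.
  by apply; rewrite (subvP (addvSr _ _)).
by rewrite xE y0 t0 !add0r.
Qed.

(** A basis of [nm] is followed by one of [h + n]. The dual vector of an element of the first is
    orthogonal to [h + n], hence in [n]; this dichotomy later puts the representative in S(n). *)
Lemma dual_bases : exists (N : nat) (e d : 'I_N -> g),
  [/\ forall x, x = \sum_i killing (d i) x *: e i,
      forall x, x = \sum_i killing x (e i) *: d i
    & forall i, e i \in (h + n)%VS \/ d i \in n].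
Proof.
pose p := \dim nm; pose q := \dim (h + n).
pose e : (p + q).-tuple g := [tuple of vbasis nm ++ vbasis (h + n)].
have basis_e : basis_of fullv e.
  case: tri => _ _ _ + <-; rewrite directvE /= => /eqP; rewrite -addvA => dimE.
  apply: cat_basis; [|exact: vbasisP|exact: vbasisP].
  apply/directv_addP/eqP; rewrite -dimv_eq0.
  by have := dimv_sum_cap nm (h + n); have := (dimv_add_leqif h n).1; lia.
pose F z := \sum_(i < p + q) killing z e`_i *: e`_i.
have linF : linear F.
  move=> a u v; rewrite scaler_sumr -big_split; apply: eq_bigr => i _ /=.
  by rewrite killingPl scalerDl scalerA.
pose LF : {linear g -> g} := HB.pack F (GRing.isLinear.Build _ _ _ _ F linF).
pose L := linfun LF.
have LE z (i : 'I_(p + q)) : coord e i (L z) = killing z e`_i.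
  by rewrite lfunE /= /F coord_sum_free ?(basis_free basis_e).
have perp_e z : (forall i : 'I_(p + q), killing z e`_i = 0) -> z = 0.
  move=> ze; apply: (killing_radical_eq0 g_ss h_cartan).
  exact: (lin_closed_basis basis_e (killing_perp_closed z)).
have kerL : lker L == 0%VS.
  rewrite -subv0; apply/subvP => z; rewrite memv_ker memv0 => /eqP Lz.
  by apply/eqP/perp_e => i; rewrite -LE Lz linear0.
(* [L] records the pairings with the basis and is injective by nondegeneracy; its inverse produces
   the dual basis. *)
pose d (i : 'I_(p + q)) := (L^-1)%VF e`_i.
have dP (i j : 'I_(p + q)) : killing (d i) e`_j = (i == j)%:R.
  by rewrite -LE /d lker0_lfunVK // coord_e // eq_sym.
exists (p + q)%N, (fun i => e`_i), d; split=> [x|x|i].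
- rewrite [LHS](coord_basis basis_e (memvf x)).
  apply: eq_bigr => i _; congr (_ *: _).
  move: x; apply: (lin_closed_basis basis_e) => [|j]; last by rewrite dP coord_e.
  split=> [|a u v IHu IHv]; first by rewrite linear0 killing0r.
  by rewrite linearP /= killingPr IHu IHv.
- apply/eqP; rewrite -subr_eq0; apply/eqP/perp_e => j.
  apply/eqP; rewrite addrC -scaleN1r killingPl mulN1r addrC subr_eq0.
  rewrite [X in _ == X]killingC killing_sumZr (bigD1 j) //= (killingC e`_j) dP.
  rewrite eqxx mulr1 big1 ?addr0 // => i ij.
  by rewrite (killingC e`_j) dP (negPf ij) mulr0.
case: (split_ordP i) => j iE; [right | left]; last first.
  rewrite iE /= nth_cat size_tuple ltnNge leq_addr /= addKn.
  by apply: vbasis_mem; apply: mem_nth; rewrite size_tuple.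
apply: perp_borel_n; apply: lin_closed_vbasis; first exact: killing_perp_closed.
move=> y /tnthP[k ->]; rewrite (tnth_nth 0).
have -> : (vbasis (h + n))`_k = e`_(rshift p k).
  by rewrite /= nth_cat size_tuple ltnNge leq_addr /= addKn.
by rewrite dP iE eq_lrshift.
Qed.

End Triangular.

(** * Polarization and the form on the symmetric algebra *)

Section Polarization.
Variable K : numFieldType.

(* [p (2 c) - 2 ^ m p c] has no term of degree [m]. *)
Lemma lin_closed_coef (M : lmodType K) (P : M -> Prop) m (T : nat -> M) :
  lin_closed P -> (forall c : K, P (\sum_(i < m) c ^+ i *: T i)) ->
  forall i, (i < m)%N -> P (T i).
Proof.
move=> clP; elim: m T => // m IHm T PT.
have PTm i : (i < m)%N -> P (T i).
  move=> im; have d0 : 2%:R ^+ i - 2%:R ^+ m != 0 :> K.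
    by rewrite subr_eq0 -!natrX eqr_nat eqn_exp2l // neq_ltn im.
  rewrite -[T i](scalerK d0); apply: (lin_closedZ clP).
  apply: (IHm (fun i => (2%:R ^+ i - 2%:R ^+ m) *: T i)) => // c.
  have := lin_closedB clP (PT (2%:R * c)) (lin_closedZ clP (2%:R ^+ m) (PT c)).
  congr P; rewrite !big_ord_recr /= scalerDr scalerA -exprMn.
  rewrite opprD addrACA subrr addr0.
  rewrite scaler_sumr -sumrB; apply: eq_bigr => j _.
  by rewrite !scalerA -scalerBl exprMn -mulrBl mulrC.
move=> i; rewrite ltnS leq_eqVlt => /orP[/eqP->|/PTm//].
have := PT 1; rewrite big_ord_recr /= expr1n scale1r => Pm.
rewrite -[T m](addKr (\sum_(i < m) 1 ^+ i *: T i)) addrC.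
apply: (lin_closedB clP) => //; apply: (lin_closed_sum clP) => j _.
by apply: (lin_closedZ clP); apply: PTm.
Qed.

(** [a] and [b] need not commute; [T 1] is the derivative of the power at [a] in the direction
    [b]. *)
Lemma expr_add_coef (A : algType K) (a b : A) k : exists T : nat -> A,
  [/\ T 0 = a ^+ k, T 1 = \sum_(i < k) a ^+ i * b * a ^+ (k.-1 - i)
    & forall c, (a + c *: b) ^+ k = \sum_(i < k.+1) c ^+ i *: T i].
Proof.
(* Vanishing of [T] above [k] is carried along because the sum for [k.+1] has one index more than
   the induction hypothesis covers. *)
suff [T [T0 T1 _ TE]] : exists T : nat -> A,
  [/\ T 0 = a ^+ k, T 1 = \sum_(i < k) a ^+ i * b * a ^+ (k.-1 - i),
      forall i, (k < i)%N -> T i = 0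
    & forall c, (a + c *: b) ^+ k = \sum_(i < k.+1) c ^+ i *: T i] by exists T.
elim: k => [|k [T [T0 T1 Tk TE]]].
  exists (fun i => (i == 0)%:R); split=> //; first by rewrite big_ord0.
    by case.
  by move=> c; rewrite big_ord1 !expr0 scale1r.
exists (fun i => a * T i + (if i is j.+1 then b * T j else 0)); split.
- by rewrite T0 addr0 exprS.
- rewrite /= T0 T1 big_ord_recl /= expr0 mul1r subn0 addrC mulr_sumr.
  congr (_ + _).
  apply: eq_bigr => i _; rewrite /bump /= exprS !mulrA; congr (_ * _ ^+ _).
  by rewrite -subn1 subnDA subn1.
- by case=> // i ki; rewrite !Tk ?mulr0 ?addr0 // ltnW.
move=> c; rewrite exprS TE mulrDl.
under [RHS]eq_bigr do rewrite scalerDr.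
rewrite [RHS]big_split /=; congr (_ + _).
  rewrite [RHS]big_ord_recr /= Tk // mulr0 scaler0 addr0 mulr_sumr.
  by apply: eq_bigr => i _; rewrite scalerAr.
rewrite [RHS]big_ord_recl /= scaler0 add0r mulr_sumr.
by apply: eq_bigr => i _; rewrite /bump /= exprS -scalerAl -scalerAr scalerA.
Qed.

Lemma expr_add_coef_com (A : comAlgType K) (a b : A) k : exists T : nat -> A,
  T 1 = b * a ^+ k *+ k.+1 /\
  forall c, (a + c *: b) ^+ k.+1 = \sum_(i < k.+2) c ^+ i *: T i.
Proof.
have [T [_ T1 TE]] := expr_add_coef a b k.+1; exists T; split=> //.
rewrite T1 (eq_bigr (fun=> b * a ^+ k)) ?sumr_const ?card_ord // => i _.
by rewrite mulrAC -exprD /= subnKC ?[a ^+ k * b]mulrC // -ltnS.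
Qed.

Variables (V : lmodType K) (A : comAlgType K) (phi : {linear V -> A}).

(** Polarization: letters are absorbed into a power one by one, since [phi z * phi y ^+ m] is, up to
    the factor [m.+1], the coefficient of [c] in [phi (y + c z) ^+ m.+1]. *)
Lemma power_span (P : A -> Prop) k : lin_closed P ->
  (forall x, P (phi x ^+ k)) ->
  forall s, size s = k -> P (\prod_(x <- s) phi x).
Proof.
move=> clP Pk s sk.
suff H (l : seq V) m y : (size l + m = k)%N ->
    P ((\prod_(x <- l) phi x) * phi y ^+ m).
  by have := H s 0%N 0; rewrite addn0 mulr1; apply.
elim: l m y => [|z l IHl] m y /= lm.
  by rewrite big_nil mul1r -[m]add0n lm.
have [T [T1 TE]] := expr_add_coef_com (phi y) (phi z) m.
have m0 : (m.+1%:R : K) != 0 by rewrite pnatr_eq0.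
have -> : (\prod_(x <- z :: l) phi x) * phi y ^+ m =
    m.+1%:R^-1 *: ((\prod_(x <- l) phi x) * T 1).
  by rewrite T1 -scaler_nat -scalerAr scalerK // big_cons mulrCA mulrA.
apply: (lin_closedZ clP).
apply: (lin_closed_coef (T := fun i => (\prod_(x <- l) phi x) * T i)
  (m := m.+2)) => // c.
rewrite /=; under eq_bigr do rewrite scalerAr.
rewrite -mulr_sumr -TE -linearZ -linearD; apply: IHl.
by rewrite addnS -addSn.
Qed.

End Polarization.

Section LSpan.
Variables (K : fieldType) (M : lmodType K) (P : M -> Prop).

Lemma lspan_gen w : P w -> lspan P w.
Proof.
move=> Pw; exists 1%N, (fun=> 1), (fun=> w); split=> //.
by rewrite big_ord1 scale1r.
Qed.

Lemma lspan_closed : lin_closed (lspan P).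
Proof.
split=> [|a x y [m [c [p [Pp ->]]]] [m' [c' [p' [Pp' ->]]]]].
  by exists 0%N, (fun=> 0), (fun=> 0); split; [case | rewrite big_ord0].
exists (m + m')%N,
  (fun i => match split i with inl j => a * c j | inr j => c' j end),
  (fun i => match split i with inl j => p j | inr j => p' j end); split.
  by move=> i; case: split.
rewrite big_split_ord scaler_sumr; congr (_ + _); apply: eq_bigr => i _.
  by rewrite (unsplitK (inl _ i)) scalerA.
by rewrite (unsplitK (inr _ i)).
Qed.

Lemma lspan_ind (Q : M -> Prop) : lin_closed Q -> (forall w, P w -> Q w) ->
  forall w, lspan P w -> Q w.
Proof.
move=> clQ PQ w [m [c [p [Pp ->]]]]; apply: (lin_closed_sum clQ) => i _.
by apply: (lin_closedZ clQ); apply: PQ.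
Qed.

End LSpan.

Section KillingForm.
Variables (K : numFieldType) (g : lieAlgType K).
Variables (S : comAlgType K) (sigma : {linear g -> S}).
Variables (B : S -> S -> K).
Hypothesis hB : is_killing_extension sigma B.
Implicit Types (x y z : g) (w : S).

Lemma Sgr_closed k : lin_closed (Sgr sigma k).
Proof. exact: lspan_closed. Qed.

Lemma Sgr_prod (s : seq g) : Sgr sigma (size s) (\prod_(x <- s) sigma x).
Proof. by apply: lspan_gen; exists s. Qed.

Lemma Sgr_prod_ord k (x : 'I_k -> g) : Sgr sigma k (\prod_i sigma (x i)).
Proof.
have := Sgr_prod [seq x i | i <- enum 'I_k].
by rewrite size_map size_enum_ord big_map big_enum.
Qed.

Lemma Sgr_ind k (P : S -> Prop) : lin_closed P ->
  (forall x, P (sigma x ^+ k)) -> forall w, Sgr sigma k w -> P w.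
Proof.
move=> clP Pk; apply: lspan_ind => // w [s sk ->].
exact: power_span sk.
Qed.

Lemma killing_extPr u a w w' : B u (a *: w + w') = a * B u w + B u w'.
Proof. by case: hB => linB _ _ _; apply: linB. Qed.

Lemma killing_extC u w : B u w = B w u.
Proof. by case: hB. Qed.

Lemma killing_extPl u a w w' : B (a *: w + w') u = a * B w u + B w' u.
Proof. by rewrite !(killing_extC _ u) killing_extPr. Qed.

Lemma killing_ext0r u : B u 0 = 0.
Proof. by have := killing_extPr u (-1) 0 0; rewrite scaler0 addr0 mulN1r addNr. Qed.

Lemma killing_extZl u a w : B (a *: w) u = a * B w u.
Proof.
by rewrite -[a *: w]addr0 killing_extPl (killing_extC 0) killing_ext0r addr0.
Qed.

Lemma killing_ext_sumZl (I : finType) u (c : I -> K) (w : I -> S) :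
  B (\sum_i c i *: w i) u = \sum_i c i * B (w i) u.
Proof.
apply: (big_rec2 (fun (x : S) (y : K) => B x u = y)) => [|i y x _ <-].
  by rewrite killing_extC killing_ext0r.
by rewrite killing_extPl.
Qed.

(* Polarization in the product algebra [S * K^o]. *)
Lemma killing_ext_prod_exp (s : seq g) k y : size s = k ->
  B (\prod_(x <- s) sigma x) (sigma y ^+ k) = k`!%:R * \prod_(x <- s) killing x y.
Proof.
move=> sk.
pose phi x : S * K^o := (sigma x, killing x y).
have lin_phi : linear phi.
  by move=> a u v; rewrite /phi linearP killingPl.
pose Phi : {linear g -> (S * K^o)%type} :=
  HB.pack phi (GRing.isLinear.Build _ _ _ _ phi lin_phi).
pose P (u : S * K^o) := B u.1 (sigma y ^+ k) = k`!%:R * u.2.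
have clP : lin_closed P.
  split=> [|a u v]; first by rewrite /P /= killing_extC killing_ext0r mulr0.
  by rewrite /P /= killing_extPl => -> ->; rewrite mulrDr mulrCA.
have : P (\prod_(x <- s) Phi x).
  apply: power_span sk => // x; rewrite /P (rmorphXn fst) (rmorphXn snd) /=.
  by case: hB => _ _ _ ->.
by rewrite /P (rmorph_prod fst) (rmorph_prod snd).
Qed.

End KillingForm.

(** * Representing functionals on S^k(g) through dual bases *)

Section DualPower.
Variables (K : numFieldType) (g : lieAlgType K).
Variables (S : comAlgType K) (sigma : {linear g -> S}).
Variables (B : S -> S -> K).
Hypothesis hB : is_killing_extension sigma B.
Variables (N : nat) (e d : 'I_N -> g).
Hypothesis expand_e : forall x, x = \sum_i killing (d i) x *: e i.
Hypothesis expand_d : forall x, x = \sum_i killing x (e i) *: d i.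
Implicit Types (x y z : g) (w : S).

Lemma power_expand (c : g -> 'I_N -> K) (u : 'I_N -> g) k x :
  x = \sum_i c x i *: u i ->
  sigma x ^+ k = \sum_(I : {ffun 'I_k -> 'I_N})
    (\prod_j c x (I j)) *: \prod_j sigma (u (I j)).
Proof.
move=> xE; rewrite {1}xE linear_sum -[in LHS](card_ord k) -prodr_const.
rewrite bigA_distr_bigA; apply: eq_bigr => I _ /=.
by under eq_bigr do rewrite linearZ /=; rewrite scaler_prod.
Qed.

Lemma killing_ext_prod_exp_ord k (x : 'I_k -> g) y :
  B (\prod_j sigma (x j)) (sigma y ^+ k) = k`!%:R * \prod_j killing (x j) y.
Proof.
have := killing_ext_prod_exp hB y (s := [seq x j | j <- enum 'I_k]) (erefl _).
by rewrite size_map size_enum_ord [X in _ = _ * X]big_map big_map !big_enum.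
Qed.

Lemma fact_unit k : (k`!%:R : K) != 0.
Proof. by rewrite pnatr_eq0 -lt0n fact_gt0. Qed.

Definition lead_of k (F : S -> K) : S :=
  k`!%:R^-1 *: \sum_(I : {ffun 'I_k -> 'I_N})
    F (\prod_j sigma (e (I j))) *: \prod_j sigma (d (I j)).

Lemma lead_of_Sgr k F : Sgr sigma k (lead_of k F).
Proof.
have cl := Sgr_closed sigma k.
apply: (lin_closedZ cl); apply: (lin_closed_sum cl) => I _.
apply: (lin_closedZ cl); exact: Sgr_prod_ord.
Qed.

(** On a power of [sigma y], pairing with a product of [d]'s gives [k!] times the coefficient of the
    matching product of [e]'s in the expansion of that power. *)
Lemma lead_of_represents k (F : S -> K) : linear (F : S -> K^o) ->
  forall w, Sgr sigma k w -> B (lead_of k F) w = F w.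
Proof.
move=> linF; pose LF : {linear S -> K^o} :=
  HB.pack F (GRing.isLinear.Build _ _ _ _ _ linF).
apply: Sgr_ind => [|y].
  split=> [|a u v IHu IHv].
    by rewrite (killing_ext0r hB); apply/esym/(linear0 LF).
  by rewrite (killing_extPr hB) IHu IHv linF.
rewrite (killing_extZl hB) (killing_ext_sumZl hB).
rewrite [in RHS](power_expand (c := fun y i => killing (d i) y) k (expand_e y)).
rewrite -[RHS]/(LF _) linear_sum mulr_sumr; apply: eq_bigr => I _.
rewrite linearZ killing_ext_prod_exp_ord /= [F _ * _]mulrCA mulKf ?fact_unit //.
by rewrite mulrC.
Qed.

(** Reproducing formula: an element of S^k is recovered from its pairings, whence nondegeneracy in
    each degree. *)
Lemma lead_of_killing_ext k w : Sgr sigma k w -> w = lead_of k (B w).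
Proof.
move: w; apply: Sgr_ind => [|x].
  split=> [|a u v]; rewrite /lead_of.
    rewrite big1 ?scaler0 // => I _.
    by rewrite (killing_extC hB) (killing_ext0r hB) scale0r.
  move=> {1}-> {1}->; rewrite scalerA mulrC -scalerA -scalerDr scaler_sumr.
  rewrite -big_split /=; congr (_ *: _); apply: eq_bigr => I _.
  by rewrite (killing_extPl hB) scalerDl scalerA.
rewrite /lead_of (power_expand (c := fun x i => killing x (e i)) k (expand_d x)).
rewrite scaler_sumr; apply: eq_bigr => I _; rewrite scalerA; congr (_ *: _).
rewrite -(power_expand (c := fun x i => killing x (e i)) k (expand_d x)).
rewrite (killing_extC hB) killing_ext_prod_exp_ord mulKf ?fact_unit //.
by apply: eq_bigr => j _; rewrite killingC.
Qed.

Lemma killing_ext_nondeg k w : Sgr sigma k w ->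
  (forall w', Sgr sigma k w' -> B w w' = 0) -> w = 0.
Proof.
move=> wk w0; rewrite (lead_of_killing_ext wk) /lead_of big1 ?scaler0 // => I _.
by rewrite w0 ?scale0r //; apply: Sgr_prod_ord.
Qed.

Lemma lead_of_Ssub k (F : S -> K) (n : {vspace g}) :
  (forall I : 'I_k -> 'I_N,
    F (\prod_j sigma (e (I j))) = 0 \/ forall j, d (I j) \in n) ->
  Ssub sigma n (lead_of k F).
Proof.
move=> Fn.
have cl : lin_closed (Ssub sigma n) by apply: lspan_closed.
apply: (lin_closedZ cl); apply: (lin_closed_sum cl) => I _.
have [->|dn] := Fn I; first by rewrite scale0r; apply: cl.1.
apply: (lin_closedZ cl); apply: lspan_gen; exists [seq d (I j) | j <- enum 'I_k].
  by move=> _ /mapP[j _ ->].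
by rewrite big_map big_enum.
Qed.

End DualPower.

(** * Invariance of the form on S(g) under the adjoint action *)

Section AdjointAction.
Variables (K : numFieldType) (g : lieAlgType K).
Variables (S : comAlgType K) (sigma : {linear g -> S}).
Variables (adS : g -> S -> S).
Hypothesis hadS : is_adjoint_action sigma adS.
Implicit Types (x y z : g) (w : S).

Lemma adS_exp x y k :
  adS x (sigma y ^+ k.+1) = (sigma (lie x y) * sigma y ^+ k) *+ k.+1.
Proof.
have [lin der gen] := hadS x.
elim: k => [|k IHk]; first by rewrite !expr1 mulr1 mulr1n gen.
by rewrite exprS der gen IHk mulrnAr mulrCA -exprS -mulrS.
Qed.

Lemma adS_linear x : linear (adS x). Proof. by case: (hadS x). Qed.

Lemma adS0 x : adS x 0 = 0.
Proof. by have := adS_linear x (-1) 0 0; rewrite scaler0 addr0 scaleN1r addNr. Qed.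

Lemma adS1 x : adS x 1 = 0.
Proof.
have [_ der _] := hadS x; have := der 1 1; rewrite !mulr1 !mul1r => E.
by apply: (addrI (adS x 1)); rewrite -E addr0.
Qed.

Lemma Sgr_mul_exp k x y : Sgr sigma k.+1 (sigma x * sigma y ^+ k).
Proof.
have := Sgr_prod sigma (x :: nseq k y).
by rewrite /= size_nseq big_cons big_nseq iter_mulr_1.
Qed.

Lemma adS_Sgr k x w : Sgr sigma k w -> Sgr sigma k (adS x w).
Proof.
have cl := Sgr_closed sigma k; move: w; apply: Sgr_ind => [|y].
  split=> [|a u v ? ?]; first by rewrite adS0; apply: cl.1.
  by rewrite adS_linear; apply: cl.2.
case: k cl => [|k] cl; first by rewrite adS1; apply: cl.1.
by rewrite adS_exp -scaler_nat; apply: (lin_closedZ cl); apply: Sgr_mul_exp.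
Qed.

Variables (B : S -> S -> K).
Hypothesis hB : is_killing_extension sigma B.

(** On powers of [sigma y] and [sigma z] both sides are the same multiple of [killing y z ^+ k]
    times a pairing with one bracket, and invariance of the Killing form moves that bracket with a
    sign. *)
Lemma killing_ext_adS k x w w' : Sgr sigma k w -> Sgr sigma k w' ->
  B (adS x w) w' = - B w (adS x w').
Proof.
move=> wk; move: w'; apply: Sgr_ind => [|z].
  split=> [|a u v IHu IHv]; first by rewrite adS0 !(killing_ext0r hB) oppr0.
  by rewrite adS_linear !(killing_extPr hB) IHu IHv opprD mulrN.
move: w wk; apply: Sgr_ind => [|y].
  split=> [|a u v IHu IHv].
    by rewrite adS0 !(killing_extC hB 0) !(killing_ext0r hB) oppr0.
  by rewrite adS_linear !(killing_extPl hB) IHu IHv opprD mulrN.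
case: k => [|k].
  by rewrite !adS1 (killing_extC hB 0) !(killing_ext0r hB) oppr0.
have pow u u' v : B (sigma u * sigma u' ^+ k) (sigma v ^+ k.+1) =
    k.+1`!%:R * (killing u v * killing u' v ^+ k).
  have := @killing_ext_prod_exp _ _ _ _ _ hB (u :: nseq k u') k.+1 v.
  by rewrite /= size_nseq !big_cons !big_nseq !iter_mulr_1; apply.
rewrite !adS_exp -!scaler_nat (killing_extZl hB) (killing_extC hB _ (_ *: _)).
rewrite (killing_extZl hB) !pow (killingC z y) lieC killingNl killing_lie.
by rewrite (killingC y) mulNr !mulrN.
Qed.

End AdjointAction.

(** A subspace inside [P] is enlarged as long as it misses a vector of [P]; finite dimension ends
    the process. *)
Lemma lin_closed_vspace (K : fieldType) (V : vectType K) (P : V -> Prop) :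
  lin_closed P -> exists W : {vspace V}, forall x, x \in W <-> P x.
Proof.
move=> clP.
suff H (W : {vspace V}) : (forall x, x \in W -> P x) ->
    exists W' : {vspace V}, forall x, x \in W' <-> P x.
  by apply: (H 0%VS) => x /[!memv0] /eqP->; apply: clP.1.
have [m] := ubnP (\dim {:V} - \dim W); elim: m W => // m IHm W.
rewrite ltnS => le_m WP.
have [PW|/existsNP[x /not_implyP[Px /negP xW]]] :=
  pselect (forall x, P x -> x \in W).
  by exists W => x; split; [exact: WP | exact: PW].
apply: (IHm (W + <[x]>)%VS).
  have := ltn_dim_add_line xW; have := dimvS (subvf (W + <[x]>)); move: le_m; lia.
move=> _ /memv_addP[y yW [_ /vlineP[a ->] ->]]; rewrite addrC.
by apply: clP.2 => //; apply: WP.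
Qed.

Lemma commutator_exp (A : pzRingType) (x y : A) k :
  x * y ^+ k - y ^+ k * x =
  \sum_(i < k) y ^+ i * (x * y - y * x) * y ^+ (k.-1 - i).
Proof.
elim: k => [|k IHk]; first by rewrite big_ord0 mulr1 mul1r subrr.
rewrite big_ord_recl /= expr0 mul1r subn0.
under eq_bigr => i _.
  rewrite /bump /= exprS -!mulrA (_ : (k - (1 + i) = k.-1 - i)%N); last first.
    by rewrite subnDA subn1.
  over.
rewrite -mulr_sumr.
under eq_bigr do rewrite mulrA.
rewrite -IHk mulrBl mulrBr !exprS -!mulrA addrA subrK.
by [].
Qed.

(** * The leading term of the functional *)

Section LeadingTerm.
Variables (K : numFieldType) (g : lieAlgType K) (nm h n : {vspace g}).
Hypothesis g_ss : semisimple_alg g.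
Hypothesis tri : triangular_decomposition nm h n.
Variables (U : algType K) (iota : {linear g -> U}).
Hypothesis iota_lie : forall x y,
  iota (lie x y) = iota x * iota y - iota y * iota x.
Variables (f : U -> K) (nu nu_star : hform h).
Hypothesis f_linear : linear (f : U -> K^o).
Hypothesis f_nl : forall x u, x \in n -> f (iota x * u) = 0.
Hypothesis f_nr : forall x u, x \in n -> f (u * iota x) = 0.
Hypothesis f_hl : forall (t : subvs_of h) u,
  f (iota (vsval t) * u) = - (nu_star t * f u).
Hypothesis f_hr : forall (t : subvs_of h) u,
  f (u * iota (vsval t)) = nu t * f u.
Implicit Types (x y z : g) (u : U).

Let fL : {linear U -> K^o} :=
  HB.pack f (GRing.isLinear.Build _ _ _ _ f f_linear).

Let f_B u u' : f (u - u') = f u - f u'.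
Proof. exact: (linearB fL). Qed.

Let f_D u u' : f (u + u') = f u + f u'.
Proof. exact: (linearD fL). Qed.

Let f_sum (I : Type) (r : seq I) (P : pred I) (F : I -> U) :
  f (\sum_(i <- r | P i) F i) = \sum_(i <- r | P i) f (F i).
Proof. exact: (linear_sum fL). Qed.

Lemma biweight_commutator_n x u : x \in n -> f (iota x * u - u * iota x) = 0.
Proof. by move=> xn; rewrite f_B f_nl // f_nr // subrr. Qed.

Lemma biweight_commutator_h (t : subvs_of h) u :
  f (iota (vsval t) * u - u * iota (vsval t)) = - ((nu + nu_star) t * f u).
Proof. by rewrite f_B f_hl f_hr add_lfunE mulrDl opprD addrC. Qed.

(** If [f 1] were nonzero, comparing the left and right actions of [h] on 1 would give
    [nu + nu_star = 0]; then [phi] kills all brackets. *)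
Lemma biweight_one : nu != 0 -> f 1 = 0.
Proof.
apply: contraNeq => c0.
have [N [e [d [expand_e _ _]]]] := dual_bases g_ss tri.
have nu0 (t : subvs_of h) : (nu + nu_star) t = 0.
  have := f_hl t 1; rewrite mulr1 -[iota _]mul1r f_hr => /eqP.
  rewrite -addr_eq0 -mulrDl mulf_eq0 (negPf c0) orbF => /eqP.
  by rewrite add_lfunE.
pose phi z := f (iota z).
have phiD a x y : phi (a *: x + y) = a * phi x + phi y.
  by rewrite /phi linearP; apply: f_linear.
have phi_add x y : phi (x + y) = phi x + phi y.
  by rewrite -[x]scale1r phiD mul1r scale1r.
have phi_lie x y : phi (lie x y) = f (iota x * iota y - iota y * iota x).
  by rewrite /phi iota_lie.
have phi0 : phi 0 = 0 by rewrite /phi linear0; apply: (linear0 fL).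
have phi_n x y : x \in n -> phi (lie x y) = 0.
  by move=> xn; rewrite phi_lie biweight_commutator_n.
have phi_h x y : x \in h -> phi (lie x y) = 0.
  move=> xh; rewrite phi_lie -(vsprojK xh) biweight_commutator_h nu0.
  by rewrite mul0r oppr0.
(* Vectors of nonzero weight are multiples of brackets with [h]. *)
have phi_nm : forall y, y \in nm -> phi y = 0.
  apply: (hstable_off_ind (tri_cartan tri) (tri_nm_hstable tri) (tri_cap tri).1).
    by split=> [|a x y IHx IHy]; rewrite ?phi0 // phiD IHx IHy mulr0 addr0.
  move=> al s y _ yal als; apply: (mulfI als).
  rewrite -[al s * _]addr0 -[X in _ + X]phi0 -phiD addr0 -yal.
  by rewrite phi_h ?subvsP ?mulr0.
have phi_lie0 x y : phi (lie x y) = 0.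
  have [x1 [x2 [x3 [x1m x2h x3n ->]]]] := tri_decomp tri x.
  rewrite !lieDl !phi_add (phi_h x2) // (phi_n x3) // !addr0.
  have [y1 [y2 [y3 [y1m y2h y3n ->]]]] := tri_decomp tri y.
  rewrite !lieDr !phi_add phi_nm; last exact: (tri_nm_subalgebra tri).
  have phiN a b : phi (lie b a) = 0 -> phi (lie a b) = 0.
    by rewrite lieC -scaleN1r -[_ *: _]addr0 phiD phi0 addr0 mulN1r => /eqP;
      rewrite oppr_eq0 => /eqP.
  by rewrite add0r (phiN _ _ (phi_h _ _ y2h)) (phiN _ _ (phi_n _ _ y3n)) addr0.
(* The Killing representative of [phi]; it is central because [phi] kills brackets. *)
pose p := \sum_i phi (e i) *: d i.
have pP z : killing p z = phi z.
  rewrite killingC killing_sumZr {2}[z]expand_e /phi linear_sum f_sum.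
  apply: eq_bigr => i _; rewrite linearZ /= killingC -[_ *: _]addr0 mulrC.
  by rewrite f_linear -[0 in RHS](linear0 iota) -/(phi 0) phi0 addr0.
have p0 : p = 0.
  apply: (central_eq0 g_ss) => x.
  apply: (killing_radical_eq0 g_ss (tri_cartan tri)) => y.
  by rewrite killing_lie pP.
apply/eqP/lfunP => t; rewrite zero_lfunE; apply: (mulIf c0).
by rewrite -f_hr mul1r -/(phi _) -pP p0 killing0l mul0r.
Qed.

Variable k : nat.
Hypothesis f_low : forall s : seq g,
  (size s < k.+1)%N -> f (\prod_(x <- s) iota x) = 0.

(* Moving [iota z] past [iota y] costs a word of length [k], killed by [f]. *)
Lemma biweight_shift y z i j : (i + j = k)%N ->
  f (iota y ^+ i * iota z * iota y ^+ j) = f (iota z * iota y ^+ k).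
Proof.
elim: i j => [|i IHi] j; first by rewrite add0n mul1r => ->.
move=> ijk; have := IHi j.+1; rewrite addnS -addSn => /(_ ijk) <-.
apply/eqP; rewrite -subr_eq0 -f_B; apply/eqP.
have -> : iota y ^+ i.+1 * iota z * iota y ^+ j
          - iota y ^+ i * iota z * iota y ^+ j.+1 =
    \prod_(x <- nseq i y ++ lie y z :: nseq j y) iota x.
  rewrite big_cat big_cons !big_nseq !iter_mulr_1 iota_lie exprSr exprS !mulrA /=.
  by rewrite -!mulrBl -!mulrA -mulrBr mulrA.
by apply: f_low; rewrite size_cat /= !size_nseq; lia.
Qed.

Variables (S : comAlgType K) (sigma : {linear g -> S}) (tau : S -> U).
Hypothesis htau : is_symmetrization sigma iota tau.

Let F (w : S) := f (tau w).

Lemma lead_functional_linear : linear (F : S -> K^o).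
Proof. by case: htau => lin _ a w w'; rewrite /F lin; apply: f_linear. Qed.

(* Both sides are the coefficient of [c] in [f (iota (y + c z) ^+ k.+1)]. *)
Lemma lead_functional_deriv y z : F ((sigma z * sigma y ^+ k) *+ k.+1) =
  f (\sum_(i < k.+1) iota y ^+ i * iota z * iota y ^+ (k - i)).
Proof.
have [TS [TS1 TSE]] := expr_add_coef_com (sigma y) (sigma z) k.
have [TU [_ TU1 TUE]] := expr_add_coef (iota y) (iota z) k.+1.
pose LF : {linear S -> K^o} :=
  HB.pack F (GRing.isLinear.Build _ _ _ _ F lead_functional_linear).
apply/eqP; rewrite -subr_eq0 -TS1 -[\sum_(i < _) _]TU1; apply/eqP.
(* With the predicate [a = 0], two polynomials in [c] that agree at every value have equal
   coefficients. *)
apply: (lin_closed_coef (M := K^o) (P := fun a => a = 0) (m := k.+2)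
  (T := fun i => F (TS i) - f (TU i) : K^o)) => //.
  by split=> [|a x y' -> ->] //; rewrite scaler0 addr0.
move=> c; under eq_bigr do rewrite /= scalerBr.
rewrite sumrB; apply/eqP; rewrite subr_eq0; apply/eqP.
transitivity (LF (\sum_(i < k.+2) c ^+ i *: TS i)).
  by rewrite linear_sum; apply: eq_bigr => i _; rewrite linearZ.
transitivity (fL (\sum_(i < k.+2) c ^+ i *: TU i)); last first.
  by rewrite linear_sum; apply: eq_bigr => i _; rewrite linearZ.
rewrite -TSE -TUE /= /F -!linearZ -!linearD.
by case: htau => _ ->.
Qed.

(** By the derivative formula and [biweight_shift], it suffices that [f (iota z * iota y ^+ k)]
    vanishes: the [n]-part of [z] is killed on the left, and the [h]-part multiplies by a scalar the
    value of [f] on a word of length [k]. *)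
Lemma lead_functional_borel z y :
  z \in (h + n)%VS -> F (sigma z * sigma y ^+ k) = 0.
Proof.
move=> zb; have k0 : (k.+1%:R : K) != 0 by rewrite pnatr_eq0.
apply: (mulfI k0); rewrite mulr0.
pose LF : {linear S -> K^o} :=
  HB.pack F (GRing.isLinear.Build _ _ _ _ F lead_functional_linear).
rewrite mulr_natl -(raddfMn LF) /= lead_functional_deriv f_sum big1 // => i _.
rewrite biweight_shift; last by rewrite subnKC // -ltnS.
have /memv_addP[t th [x xn ->]] := zb.
rewrite linearD mulrDl f_D [X in _ + X]f_nl // addr0 -(vsprojK th) f_hl.
have := f_low (s := nseq k y); rewrite size_nseq big_nseq iter_mulr_1 => -> //.
by rewrite mulr0 oppr0.
Qed.

Lemma lead_functional_prod (x : 'I_k.+1 -> g) j :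
  x j \in (h + n)%VS -> F (\prod_i sigma (x i)) = 0.
Proof.
move=> xj; rewrite (bigD1 j) //=.
pose LF : {linear S -> K^o} :=
  HB.pack F (GRing.isLinear.Build _ _ _ _ F lead_functional_linear).
have := power_span (phi := sigma) (P := fun w => F (sigma (x j) * w) = 0)
  (k := k).
move=> /(_ _ _ [seq x i | i <- enum (predC1 j)]).
rewrite size_map -cardE cardC1 card_ord big_map big_enum; apply=> //.
  split=> [|a w w' Hw Hw']; first by rewrite mulr0; apply: (linear0 LF).
  by rewrite mulrDr -scalerAr lead_functional_linear Hw Hw' scaler0 addr0.
by move=> y; apply: lead_functional_borel.
Qed.

Variables (adS : g -> S -> S).
Hypothesis hadS : is_adjoint_action sigma adS.

(** Both sides are [f] of the sum of the products [y^i [x, y] y^(k - i)]; this is the compatibility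
    of [tau] with the adjoint actions, seen through [f]. *)
Lemma lead_functional_adS x y : F (adS x (sigma y ^+ k.+1)) =
  f (iota x * iota y ^+ k.+1 - iota y ^+ k.+1 * iota x).
Proof.
by rewrite (adS_exp hadS) lead_functional_deriv commutator_exp iota_lie.
Qed.

Variables (B : S -> S -> K).
Hypothesis hB : is_killing_extension sigma B.

(** Existence comes from dual bases and uniqueness from nondegeneracy; the action of [h] and [n] is
    tested by pairing with powers. *)
Lemma lead_term : exists w : S,
  unique (represents_lead sigma B tau f k.+1) w /\
  Sn_inv_weight sigma n adS (nu + nu_star) w.
Proof.
have [N [e [d [expand_e expand_d e_or_d]]]] := dual_bases g_ss tri.
pose w := lead_of sigma e d k.+1 F.
have wS : Sgr sigma k.+1 w := lead_of_Sgr _ _ _ _ _.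
have wP w' : Sgr sigma k.+1 w' -> B w w' = F w'.
  exact: (lead_of_represents hB expand_e lead_functional_linear).
have nondeg := killing_ext_nondeg hB expand_d.
have cl := Sgr_closed sigma k.+1.
have F0 : F 0 = 0 by have := wP 0 cl.1; rewrite (killing_ext0r hB).
(* The minus sign in the premise cancels the one produced by moving [adS x] across the form. *)
have adS_eq x (c : K) :
    (forall y, f (iota x * iota y ^+ k.+1 - iota y ^+ k.+1 * iota x)
               = - (c * f (iota y ^+ k.+1))) -> adS x w = c *: w.
  move=> fx; apply/eqP; rewrite -subr_eq0; apply/eqP; apply: (nondeg k.+1).
    apply: (lin_closedB cl); first exact: adS_Sgr.
    exact: lin_closedZ.
  move=> w' w'S; rewrite addrC -scaleNr (killing_extPl hB).
  rewrite (killing_ext_adS hadS hB _ wS w'S) !wP //; last exact: adS_Sgr.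
  move: w' w'S; apply: Sgr_ind => [|y].
    split=> [|a u u' IHu IHu'].
      by rewrite (adS0 hadS) F0 mulr0 subr0.
    rewrite (adS_linear hadS) !lead_functional_linear /GRing.scale /=.
    rewrite mulrDr opprD addrACA mulrCA -mulrN -mulrDr IHu IHu' mulr0 addr0.
    by [].
  rewrite lead_functional_adS fx /F; case: htau => _ ->.
  by rewrite opprK mulNr addNr.
exists w; split.
  split=> [|w' [w'S w'P]]; first by split.
  apply/eqP; rewrite -subr_eq0; apply/eqP; apply: (nondeg k.+1).
    exact: (lin_closedB cl).
  move=> u uS; rewrite addrC -scaleN1r (killing_extPl hB) wP // w'P //.
  by rewrite mulN1r addNr.
split=> [|x xn|t].
- apply: lead_of_Ssub => I.
  (* One [e] in [h + n] makes the coefficient vanish; otherwise every matching [d] lies in [n]. *)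
  have [/existsP[j ej]|/existsPn en] :=
    boolP [exists j, e (I j) \in (h + n)%VS].
    by left; apply: lead_functional_prod ej.
  by right=> j; case: (e_or_d (I j)) => // eb; have := en j; rewrite eb.
- rewrite (adS_eq x 0) ?scale0r // => y.
  by rewrite biweight_commutator_n // mul0r oppr0.
by apply: adS_eq => y; rewrite biweight_commutator_h.
Qed.

End LeadingTerm.

(** * The matrix coefficient and its codegree *)

Section MatrixCoefficient.
Variables (K : numFieldType) (g : lieAlgType K) (V : vectType K).
Variables (pi : g -> 'End(V)) (U : algType K) (iota : {linear g -> U}).
Variables (piU : U -> 'End(V)).
Hypothesis hpiU : extends_rep iota pi piU.

Lemma dual_repE x (phi : dual_space V) u : dual_rep pi x phi u = - phi (pi x u).
Proof.
pose F (phi : dual_space V) : dual_space V := - (phi \o pi x)%VF.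
have linF : linear F.
  move=> a p q; apply/lfunP => y.
  rewrite !(opp_lfunE, add_lfunE, scale_lfunE, comp_lfunE) opprD.
  by rewrite scalerN.
pose LF : {linear dual_space V -> dual_space V} :=
  HB.pack F (GRing.isLinear.Build _ _ _ _ F linF).
by rewrite /dual_rep (lfunE LF) /= /F opp_lfunE comp_lfunE.
Qed.

(** The vectors whose images under all words are killed by [v_star] form an invariant subspace. If
    it contained [v] it would be all of [V], and the empty word would give [v_star = 0]. *)
Lemma matrix_coefficient_neq0 (v : V) (v_star : dual_space V) :
  irreducible_rep pi -> v != 0 -> v_star != 0 ->
  exists s : seq g, v_star (piU (\prod_(x <- s) iota x) v) != 0.
Proof.
move=> [_ irr] v0 vs0; case: hpiU => linU oneU mulU genU.
apply: contrapT => /forallNP f0.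
pose P u := forall s : seq g, v_star (piU (\prod_(x <- s) iota x) u) = 0.
have clP : lin_closed P.
  split=> [s|a u w Pu Pw s]; first by rewrite !linear0.
  by rewrite 2!linearP /= Pu Pw scaler0 addr0.
have [W WP] := lin_closed_vspace clP.
have stW x : (pi x @: W <= W)%VS.
  apply/subvP => _ /memv_imgP[u /WP Pu ->]; apply/WP => s.
  have := Pu (rcons s x).
  by rewrite -cats1 big_cat big_seq1 mulU genU comp_lfunE.
have vW : v \in W.
  by apply/WP => s; apply/eqP; rewrite -[_ == _]negbK; apply/negP/f0.
case: (irr W stW) => WE.
  by case/negP: v0; rewrite -memv0 -WE.
case/negP: vs0; apply/eqP/lfunP => u; rewrite zero_lfunE.
have /WP/(_ [::]) : u \in W by rewrite WE memvf.
by rewrite big_nil oneU id_lfunE.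
Qed.

End MatrixCoefficient.

(** Words span the filtration, so the codegree is the least length of a word on which [f] does not
    vanish. *)
Lemma min_word_codegree (K : fieldType) (g : lieAlgType K) (U : algType K)
    (iota : {linear g -> U}) (f : U -> K) :
  linear (f : U -> K^o) -> (exists s : seq g, f (\prod_(x <- s) iota x) != 0) ->
  exists k, [/\ is_codegree iota f k,
    forall s : seq g, (size s < k)%N -> f (\prod_(x <- s) iota x) = 0
    & exists2 s : seq g, size s = k & f (\prod_(x <- s) iota x) != 0].
Proof.
move=> linf [s0 fs0].
pose nz k :=
  `[< exists2 s : seq g, size s = k & f (\prod_(x <- s) iota x) != 0 >].
have ex_nz : exists k, nz k by exists (size s0); apply/asboolP; exists s0.
have [k /asboolP[s sk fs] mink] := ex_minnP ex_nz.
have low s' : (size s' < k)%N -> f (\prod_(x <- s') iota x) = 0.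
  rewrite ltnNge; apply: contraNeq => fs'; apply: mink.
  by apply/asboolP; exists s'.
exists k; split=> //; last by exists s.
split; first by exists (\prod_(x <- s) iota x).
  apply: lspan_ind => [|_ [s' /low fs' ->] //].
  pose L : {linear U -> K^o} := HB.pack f (GRing.isLinear.Build _ _ _ _ f linf).
  split=> [|a u u' fu fu']; first exact: (linear0 L).
  by rewrite linf fu fu' scaler0 addr0.
move=> k' low'; rewrite leqNgt; apply: contraNN fs => kk'; apply/eqP/low'.
by apply: lspan_gen; exists s; rewrite ?sk.
Qed.

Theorem theorem2p8 (R : realType) (g : lieAlgType R[i])
    (hss : semisimple_alg g)
    (nm h n : {vspace g}) (htri : triangular_decomposition nm h n)
    (U : algType R[i]) (iota : {linear g -> U})
    (hU : is_enveloping_algebra iota)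
    (S : comAlgType R[i]) (sigma : {linear g -> S})
    (hS : is_symmetric_algebra sigma)
    (adS : g -> S -> S) (hadS : is_adjoint_action sigma adS)
    (B : S -> S -> R[i]) (hB : is_killing_extension sigma B)
    (tau : S -> U) (htau : is_symmetrization sigma iota tau)
    (nu nu_star : hform h) (hdom : dominant_integral n nu) (hnu : nu != 0)
    (V : vectType R[i]) (pi : g -> 'End(V))
    (hpi : lie_rep pi) (hirr : irreducible_rep pi)
    (piU : U -> 'End(V)) (hpiU : extends_rep iota pi piU)
    (v : V) (hv : highest_weight_vec n pi nu v)
    (v_star : dual_space V)
    (hv_star : highest_weight_vec n (dual_rep pi) nu_star v_star) :
  let f := fun u : U => v_star (piU u v) in
  exists k : nat,
    [/\ is_codegree iota f k,
        (1 <= k)%N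
      & exists w : S,
          unique (represents_lead sigma B tau f k) w /\
          Sn_inv_weight sigma n adS (nu + nu_star) w].

  move=> f.
have [pi_lin pi_lie] := hpi; have [linU oneU mulU genU] := hpiU.
have [v0 vn vh] := hv; have [vs0 vsn vsh] := hv_star.
have iota_lie := hU.1.
have f_linear : linear (f : U -> R[i]^o).
  by move=> a u u'; rewrite /f linU add_lfunE scale_lfunE linearP.
(* The sign of the dual action is the source of [- nu_star] on the left. *)
have vsE x u : v_star (pi x u) = - (dual_rep pi x v_star u).
  by rewrite dual_repE opprK.
have f_nl x u : x \in n -> f (iota x * u) = 0.
  by move=> xn; rewrite /f mulU comp_lfunE genU vsE vsn // zero_lfunE oppr0.
have f_nr x u : x \in n -> f (u * iota x) = 0.
  by move=> xn; rewrite /f mulU comp_lfunE genU vn // !linear0.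
have f_hl (t : subvs_of h) u : f (iota (vsval t) * u) = - (nu_star t * f u).
  by rewrite /f mulU comp_lfunE genU vsE vsh scale_lfunE.
have f_hr (t : subvs_of h) u : f (u * iota (vsval t)) = nu t * f u.
  by rewrite /f mulU comp_lfunE genU vh !linearZ.
(* Codegree 0 would make [f] nonzero on the empty word, that is at 1. *)
have [[|k] [codeg low [s sk fs]]] := min_word_codegree f_linear
  (matrix_coefficient_neq0 hpiU hirr v0 vs0).
  case/eqP: fs; rewrite (size0nil sk) big_nil.
  exact: (biweight_one hss htri iota_lie f_linear f_nl f_nr f_hl f_hr hnu).
exists k.+1; split=> //.
exact: (lead_term hss htri iota_lie f_linear f_nl f_nr f_hl f_hr low htau hadS hB).
Qed.
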